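(* Let $d\ge2$ and $d\le q<\infty$. Then there is a constant $C_{d,q}$ such that for every $u\in C_c^\infty(\mathbb R^d)$, $$\big\||x|^{-d/q}u\big\|_{L^{q,\infty}}\le C_{d,q}\,\|\nabla u\|_{L^{d,1}}.$$ For $q=d$ this reads $$\Big\|\frac{u}{|x|}\Big\|_{L^{d,\infty}}\le C_d\,\|\nabla u\|_{L^{d,1}}.$$ For every $r>1$, the right-hand side cannot be replaced uniformly by $\|\nabla u\|_{L^{d,r}}$; that is, there is no constant $C>0$ such that $\big\||x|^{-d/q}u\big\|_{L^{q,\infty}}\le C\|\nabla u\|_{L^{d,r}}$ for all $u\in C_c^\infty(\mathbb R^d)$.
   Context: For a measurable $f$ on $\mathbb R^d$ with decreasing rearrangement $f^*$, $\|f\|_{L^{a,b}}:=\big(\frac ba\int_0^\infty[t^{1/a}f^*(t)]^b\frac{dt}t\big)^{1/b}$ for $0<a,b<\infty$, and $\|f\|_{L^{a,\infty}}:=\sup_{t>0}t^{1/a}f^*(t)$; $\|\nabla u\|_{L^{a,b}}$ means $\||\nabla u|\|_{L^{a,b}}$. *)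

(* Defs.v *)
From HB Require Import structures.
From mathcomp Require Import all_boot all_order all_algebra.
From mathcomp Require Import all_classical all_reals all_analysis.

Set Implicit Arguments.
Unset Strict Implicit.
Unset Printing Implicit Defensive.

Import Order.TTheory GRing.Theory Num.Theory.
Import numFieldNormedType.Exports.

Local Open Scope classical_set_scope.
Local Open Scope ring_scope.

Definition measure_rV_display : measure_display -> measure_display.
Proof. exact. Qed.

(* The product sigma-algebra on row vectors, generated by the coordinates;
   over [R] it is the Borel sigma-algebra of [R^n]. *)
Section measurable_rV.
Context d (T : measurableType d) (n : nat).

Definition coord_rV (i : 'I_n) (v : 'rV[T]_n) : T := v ord0 i.

HB.instance Definition _ := @isMeasurable.Build (measure_rV_display d)
  'rV[T]_n (g_sigma_preimage coord_rV) (@sigma_algebra0 _ _ _)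
  (@sigma_algebraC _ _) (@sigma_algebra_bigcup _ _ _).

End measurable_rV.

Section measurable_fun_rV.
Context d d' (S : measurableType d) (T : measurableType d').

Lemma measurable_coord_rV n (i : 'I_n) :
  measurable_fun [set: 'rV[T]_n] (@coord_rV _ T n i).
Proof.
move=> _ Y mY; rewrite setTI; apply: sub_sigma_algebra => /=.
rewrite -bigcup_seq/=; exists i => /=; first by rewrite mem_index_enum.
by exists Y => //; rewrite setTI.
Qed.

Lemma measurable_fun_rV n (f : S -> 'rV[T]_n) :
  (forall i, measurable_fun [set: S] (@coord_rV _ T n i \o f)) ->
  measurable_fun [set: S] f.
Proof.
move=> mf; apply: (measurability
  (\big[setU/set0]_(i < n) preimage_set_system setT (@coord_rV _ T n i) measurable)) => //.
move=> _ [A + <-]; rewrite -bigcup_seq => -[i _ [B mB <-]].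
by rewrite !setTI -comp_preimage -[X in measurable X]setTI; exact: mf.
Qed.

End measurable_fun_rV.

Section lebesgue_rV.
Context {R : realType}.

Definition cons_rV n (p : 'rV[R]_n * R) :
    'rV[R]_n.+1 :=
  row_mx (const_mx p.2 : 'rV_1) p.1.

Lemma measurable_cons_rV n : measurable_fun setT (@cons_rV n).
Proof.
apply: measurable_fun_rV => i; case: (unliftP ord0 i) => [j ->|->].
- rewrite (_ : _ \o _ = @coord_rV _ R n j \o fst).
    exact: measurableT_comp (measurable_coord_rV _) measurable_fst.
  apply/funext => p /=; rewrite /coord_rV /cons_rV.
  rewrite (_ : lift ord0 j = rshift 1 (j : 'I_n)); last exact/val_inj.
  exact: (row_mxEr (const_mx p.2 : 'rV_1) p.1 ord0 j).
- rewrite (_ : _ \o _ = snd); first exact: measurable_snd.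
  apply/funext => p /=; rewrite /coord_rV /cons_rV.
  rewrite (_ : (ord0 : 'I_n.+1) = lshift n (ord0 : 'I_1)); last exact/val_inj.
  by rewrite (row_mxEl (const_mx p.2 : 'rV_1) p.1 ord0 ord0) mxE.
Qed.

Definition prod_rV n (mu : {measure set 'rV[R]_n -> \bar R}) :
    set 'rV[R]_n.+1 -> \bar R :=
  pushforward (mu \x @lebesgue_measure R)%E (@cons_rV n).

HB.instance Definition _ n (mu : {measure set 'rV[R]_n -> \bar R}) :=
  Measure.copy (prod_rV mu)
    (measure_function_pushforward__canonical__measure_function_Measure
       (mu \x @lebesgue_measure R)%E (@measurable_cons_rV n)).

(* The [n]-fold product of the Lebesgue measure of [R]; [R^0] is a point of
   mass 1. *)
Fixpoint lebesgue_rV (n : nat) : {measure set 'rV[R]_n -> \bar R} :=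
  match n with
  | 0 => \d_(0 : 'rV[R]_0)
  | m.+1 => prod_rV (lebesgue_rV m)
  end.

End lebesgue_rV.

Section lorentz.
Context d (T : measurableType d) (R : realType).
Variable mu : {measure set T -> \bar R}.
Local Open Scope ereal_scope.

(* [ereal_inf set0 = +oo], as usual. *)
Definition rearrangement (f : T -> R) (t : R) : \bar R :=
  ereal_inf [set s%:E | s in
    [set s : R | (0 <= s)%R /\ mu [set x | (s < `|f x|)%R] <= t%:E]].

(* The value at [b = -oo] is a dummy. *)
Definition lorentz_norm (a : R) (b : \bar R) (f : T -> R) : \bar R :=
  match b with
  | b%:E => ((b / a)%:E *
      \int[@lebesgue_measure R]_(t in `]0%R, +oo[%classic)
        (((t `^ a^-1)%:E * rearrangement f t) `^ b * (t^-1)%:E)) `^ b^-1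
  | +oo => ereal_sup [set (t `^ a^-1)%:E * rearrangement f t |
                        t in `]0%R, +oo[%classic]
  | -oo => 0
  end.

End lorentz.

Section test_functions.
Context {R : realType} {n : nat}.
Implicit Types (u : 'rV[R]_n -> R) (x : 'rV[R]_n).

(* The canonical norm [`|x|] of ['rV[R]_n] is the sup norm. *)
Definition eucl_norm x : R := Num.sqrt (\sum_(i < n) x ord0 i ^+ 2).

Definition partial (i : 'I_n) u : 'rV[R]_n -> R :=
  'D_(delta_mx ord0 i : 'rV[R]_n) u.

Definition grad u x : 'rV[R]_n := \row_i partial i u x.

Definition partials (s : seq 'I_n) u : 'rV[R]_n -> R := foldr partial u s.

(* The derivative operator is total, so the existence of each iterated partial
   derivative has to be required explicitly. *)
Definition smooth u : Prop :=
  forall s : seq 'I_n, continuous (partials s u) /\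
    forall (i : 'I_n) x, derivable (partials s u) x (delta_mx ord0 i).

Definition test_function u : Prop :=
  smooth u /\ compact (closure [set x | u x != 0]).

End test_functions.

(* Main.v *)
Require Import Defs.
From HB Require Import structures.
From mathcomp Require Import all_boot all_order all_algebra.
From mathcomp Require Import all_classical all_reals all_analysis.
From mathcomp Require Import measurable_realfun ring lra.

Set Implicit Arguments.
Unset Strict Implicit.
Unset Printing Implicit Defensive.

Import Order.TTheory GRing.Theory Num.Theory.
Import numFieldNormedType.Exports.

Local Open Scope classical_set_scope.
Local Open Scope ring_scope.

(** Positive part.  A function in the weak space is controlled by its supremum,
    since [|x|^(-d/q)] itself lies in weak [L^q]; it remains to bound [sup |u|] by the
    [L^(d,1)] norm of the gradient.  Integrating along the rays [t |-> x + t w] and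
    averaging over [w] in the unit box [Q], of measure 1, gives
    [|u x| <= d \int_(t > 0) \int_(w in Q) g(x + t w)] with [g = |grad u|].  With
    [m s = |{g > s}|], the layer cake formula bounds this by
    [\int_s \int_t min(1, t^-d m s)], hence by a multiple of [\int_s (m s)^(1/d)],
    and since [(m s)^(1/d) <= \int_(0 < tau < m s) tau^(1/d - 1)], exchanging the
    integrals turns this into [\int tau^(1/d - 1) g^* tau].

    Negative part.  Let [eta] be a smooth bump supported in the unit cube.  The sums
    [u_k x = \sum_(j < k) eta (2^j x)] are at least [c k] on a cube of side [2^-k],
    so their weighted weak norm is at least [c' k], while
    [|grad u_k x| <= K min(2^k, 2 / |x|)], so that their [L^(d,r)] norm is only
    [O(k^(1/r))]. *)

(** * Lebesgue measure on row vectors *)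

(** Directions range over a box rather than a sphere because the measure is built coordinate by
    coordinate: dilating a box needs only the scaling rule for volumes, and no polar coordinates
    enter. The tail of [min(1, t^-d m)] is integrable because [d >= 2], and the resulting
    [\int_s (m s)^(1/d)] is, up to constants, the [L^(d,1)] norm: this is where the second index 1
    comes from. A second obstacle is that [smooth] speaks only of iterated partial derivatives,
    whereas rays run in arbitrary directions. Strict differentiability supplies the missing chain
    rule, being additive in the direction. In the negative part all dyadic scales carry equal
    weight: [t^(1/d) g^* t] stays bounded while [t] runs from [2^(-k d)] to [2^d], a range of
    logarithmic length proportional to [k], whence [k^(1/r)]; at the origin the [k] bumps simply add
    up. The weight [|x|^(-d/q)] is scale invariant in weak [L^q], so the same sums serve every
    [q]. *)

Section scaled_pushforward.
Context d d' (S : measurableType d) (T : measurableType d') (R : realType).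
Context (f : S -> T) (mf : measurable_fun setT f).

(** Bundled as a measure so that the uniqueness theorems for Lebesgue and product measures can
    identify a rescaled image measure. *)
Definition scaled_pushforward (k : {nonneg R}) (mu : {measure set S -> \bar R}) :
    {measure set T -> \bar R} :=
  measure_function_mscale__canonical__measure_function_Measure k
    (measure_function_pushforward__canonical__measure_function_Measure mu mf).

Lemma scaled_pushforwardE k mu A :
  scaled_pushforward k mu A = (k%:num%:E * mu (f @^-1` A))%E.
Proof. by []. Qed.

End scaled_pushforward.

Section lebesgue_affine.
Context {R : realType}.
Local Notation leb := (@lebesgue_measure R).

Lemma measurable_affine (a t : R) :
  measurable_fun setT (fun s : R => a + t * s).
Proof.
by apply: measurable_funD => //; apply: measurable_funM.
Qed.

Lemma lebesgue_measure_oc (x y : R) :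
  leb `]x, y]%classic = (if x < y then y - x else 0)%:E.
Proof. by rewrite lebesgue_measure_itv/= lte_fin; case: ifP. Qed.

(** The image measure multiplied by [t] agrees with [leb] on the intervals []x, y]], and these
    determine Lebesgue measure. *)
Lemma lebesgue_affine (a t : R) (A : set R) : 0 < t -> measurable A ->
  leb ((fun s => a + t * s) @^-1` A) = (t^-1%:E * leb A)%E.
Proof.
move=> t0 mA.
have t0' : 0 <= t by exact: ltW.
pose m' := @scaled_pushforward _ _ (measurableTypeR R) (measurableTypeR R) R _
  (measurable_affine a t) (NngNum t0') leb.
have E X : measurable X -> leb X = m' X.
  move: X; apply: lebesgue_measure_unique => X [[x y] _ <-].
  rewrite /m' scaled_pushforwardE.
  have -> : (fun s => a + t * s) @^-1` `]x, y] = `](x - a) / t, (y - a) / t]%classic.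
    apply/seteqP; split=> s /=; rewrite !in_itv/= => /andP[h1 h2];
      [rewrite ltr_pdivrMr// ler_pdivlMr//|move: h1 h2; rewrite ltr_pdivrMr// ler_pdivlMr// => h1 h2];
      apply/andP; split; lra.
  transitivity (t%:E * leb `]((x - a) / t)%R, ((y - a) / t)%R]%classic)%E; last by [].
  rewrite !lebesgue_measure_oc /=.
  rewrite ltr_pM2r ?invr_gt0// ltrD2r.
  case: ifP => _; rewrite -EFinM ?mulr0//.
  by congr EFin; field; rewrite gt_eqF.
by rewrite [in RHS]E// /m' scaled_pushforwardE /= muleA -EFinM mulVf ?gt_eqF// mul1e.
Qed.

End lebesgue_affine.

Section lebesgue_rV.
Context {R : realType}.
Local Notation leb := (@lebesgue_measure R).
Local Open Scope ereal_scope.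

Definition box n (I : set R) : set 'rV[R]_n := [set v | forall i, I (v ord0 i)].

Lemma measurable_box n (I : set R) : measurable I -> measurable (@box n I).
Proof.
move=> mI; rewrite (_ : box I = \bigcap_(i in [set: 'I_n]) (@coord_rV _ R n i @^-1` I)).
  apply: fin_bigcap_measurable; first exact: finite_finset.
  by move=> i _; rewrite -[X in measurable X]setTI; exact: measurable_coord_rV.
by apply/seteqP; split => v /=; [move=> h i _; exact: h|move=> h i; exact: h].
Qed.

Lemma cons_rV0 n (p : 'rV[R]_n * R) : cons_rV p ord0 ord0 = p.2.
Proof.
rewrite /cons_rV.
have -> : (ord0 : 'I_n.+1) = lshift n (ord0 : 'I_1) by exact/val_inj.
by rewrite (row_mxEl (const_mx p.2 : 'rV_1) p.1 ord0 ord0) mxE.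
Qed.

Lemma cons_rVS n (p : 'rV[R]_n * R) j : cons_rV p ord0 (lift ord0 j) = p.1 ord0 j.
Proof.
rewrite /cons_rV.
rewrite (_ : lift ord0 j = rshift 1 (j : 'I_n)); last exact/val_inj.
exact: (row_mxEr (const_mx p.2 : 'rV_1) p.1 ord0 j).
Qed.

Lemma lebesgue_rV_box n (I : set R) : measurable I ->
  lebesgue_rV n (@box n I) = leb I ^+ n.
Proof.
move=> mI; elim: n => [|n IH]; first by rewrite expe0 /= diracE mem_set// => -[].
rewrite expeS /= /prod_rV /pushforward.
rewrite (_ : _ @^-1` _ = @box n I `*` I).
  by rewrite product_measure1E//; [rewrite IH muleC|exact: measurable_box].
apply/seteqP; split=> -[v s] /=.
  move=> h; split; last by have := h ord0; rewrite cons_rV0.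
  by move=> i; have := h (lift ord0 i); rewrite cons_rVS.
move=> [h1 h2] i; case: (unliftP ord0 i) => [j ->|->]; first by rewrite cons_rVS; exact: h1.
by rewrite cons_rV0.
Qed.

Lemma sigma_finite_lebesgue_rV n : sigma_finite setT (lebesgue_rV n : set 'rV[R]_n -> \bar R).
Proof.
exists (fun k => @box n `[(- k%:R)%R, k%:R%R]%classic).
  apply/esym/seteqP; split=> // v _.
  exists (Num.bound (\sum_(i < n) `|v ord0 i|)%R) => // i; rewrite /= in_itv/= -ler_norml.
  apply: (@le_trans _ _ (\sum_(i < n) `|v ord0 i|)%R).
    by rewrite (bigD1 i)//= lerDl sumr_ge0.
  by rewrite ltW// archi_boundP// sumr_ge0.
move=> k; split; first exact: measurable_box.
rewrite lebesgue_rV_box// lebesgue_measure_itv/=.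
by case: ifP => _; [rewrite -EFinD|rewrite -[0%R]/(0%:E)]; rewrite -EFin_expe ltry.
Qed.

(* [lebesgue_rV n] is an already bundled measure, to which no instance can be
   attached; this copy carries the sigma-finiteness that Tonelli's theorem needs. *)
Definition leb_rV n : set 'rV[R]_n -> \bar R := lebesgue_rV n.
HB.instance Definition _ n := Measure.copy (@leb_rV n) (lebesgue_rV n).
HB.instance Definition _ n := Measure_isSigmaFinite.Build _ _ _ (@leb_rV n)
  (sigma_finite_lebesgue_rV n).

Lemma measurable_affine_rV n (x : 'rV[R]_n) (t : R) :
  measurable_fun setT (fun w : 'rV[R]_n => x + t *: w)%R.
Proof.
apply: measurable_fun_rV => i; rewrite (_ : _ \o _ = (fun s => x ord0 i + t * s)%R \o @coord_rV _ R n i).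
  by apply: measurableT_comp; [exact: measurable_affine|exact: measurable_coord_rV].
by apply/funext => w; rewrite /= /coord_rV !mxE.
Qed.

(** Induction on the dimension: seen through [cons_rV], the map acts separately on coordinate 0 and
    on the remaining ones, so the rescaled image measure has the right value on rectangles and is
    the product measure by uniqueness. *)
Lemma lebesgue_rV_affine n (x : 'rV[R]_n) (t : R) (A : set 'rV[R]_n) :
  (0 < t)%R -> measurable A ->
  leb_rV ((fun w => x + t *: w)%R @^-1` A) = (t^-1 ^+ n)%:E * leb_rV A.
Proof.
move=> t0; have t0' : (0 <= t ^+ n.+1)%R by rewrite exprn_ge0// ltW.
elim: n x A {t0'} => [|n IH] x A mA.
  rewrite expr0 mul1e; congr leb_rV; apply/seteqP; split=> w /=.
    by rewrite (_ : (x + t *: w)%R = w)//; apply/rowP; case.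
  by rewrite (_ : (x + t *: w)%R = w)//; apply/rowP; case.
have t0' : (0 <= t ^+ n.+1)%R by rewrite exprn_ge0// ltW.
pose x1 : 'rV[R]_n := (\row_i x ord0 (lift ord0 i))%R.
pose f (p : 'rV[R]_n * R) : 'rV[R]_n * R := (x1 + t *: p.1, x ord0 ord0 + t * p.2)%R.
have mf : measurable_fun setT f.
  apply/measurable_fun_pairP; split.
    exact: (measurableT_comp (measurable_affine_rV x1 t) measurable_fst).
  exact: (measurableT_comp (measurable_affine (x ord0 ord0) t) measurable_snd).
pose T : measurableType _ := ('rV[R]_n * measurableTypeR R)%type.
pose m' := @scaled_pushforward _ _ T T R f mf (NngNum t0') (@leb_rV n \x leb).
have E X : measurable X -> (@leb_rV n \x leb) X = m' X.
  apply: product_measure_unique => A1 B mA1 mB.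
  transitivity ((t ^+ n.+1)%:E * (@leb_rV n \x leb) (((fun w => x1 + t *: w)%R @^-1` A1) `*`
      ((fun s => x ord0 ord0 + t * s)%R @^-1` B))); first by [].
  rewrite product_measure1E; last 2 first.
  - by rewrite -[X in measurable X]setTI; exact: measurable_affine_rV.
  - by rewrite -[X in measurable X]setTI; exact: measurable_affine.
  have e1 := IH x1 A1 mA1; have e2 := lebesgue_affine (x ord0 ord0) t0 mB.
  transitivity ((t ^+ n.+1)%:E * ((t^-1 ^+ n)%:E * leb_rV A1 * (t^-1%:E * leb B))).
    by rewrite -e1 -e2.
  rewrite (muleACA (t^-1 ^+ n)%:E) -EFinM (muleA (t ^+ n.+1)%:E) -EFinM.
  by rewrite -exprSr -exprMn divff ?gt_eqF// expr1n mul1e.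
rewrite /leb_rV /= /prod_rV /pushforward.
have mc : measurable ((@cons_rV R n) @^-1` A).
  by rewrite -[X in measurable X]setTI; exact: measurable_cons_rV.
rewrite -/(@leb_rV n) [in RHS]E// /m' scaled_pushforwardE /= muleA -EFinM.
rewrite -exprMn mulVf ?gt_eqF// expr1n mul1e; congr (_ _).
have fE p : cons_rV (f p) = (x + t *: cons_rV p)%R.
  apply/rowP => i; case: (unliftP ord0 i) => [j ->|->].
    transitivity (x ord0 (lift ord0 j) + t * cons_rV p ord0 (lift ord0 j))%R.
      by rewrite [LHS](cons_rVS (f p)) cons_rVS !mxE.
    by rewrite [RHS]mxE [X in (_ = _ + X)%R]mxE.
  transitivity (x ord0 ord0 + t * cons_rV p ord0 ord0)%R.
    by rewrite [LHS](cons_rV0 (f p)) cons_rV0.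
  by rewrite [RHS]mxE [X in (_ = _ + X)%R]mxE.
by apply/seteqP; split=> p /=; rewrite fE.
Qed.
End lebesgue_rV.

(** * Borel measurability of continuous functions on row vectors *)

Section continuous_measurable_rV.
Context {R : realType} {n : nat}.

Lemma ball_rVE (x : 'rV[R]_n) (e : R) : 0 < e ->
  ball x e = [set y | forall i, `|x ord0 i - y ord0 i| < e].
Proof.
move=> e0; apply/seteqP; split=> y.
  by move=> [_ xy] i; exact: xy.
by move=> xy; split=> // i j; rewrite (ord1 i); exact: xy.
Qed.

Lemma measurable_ball_rV (x : 'rV[R]_n) (e : R) : 0 < e -> measurable (ball x e).
Proof.
move=> e0; rewrite ball_rVE//.
rewrite [X in measurable X](_ : _ = \bigcap_(i in [set: 'I_n]) (@coord_rV _ R n i @^-1` (ball (x ord0 i) e))).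
  apply: fin_bigcap_measurable; first exact: finite_finset.
  move=> i _; rewrite -[X in measurable X]setTI; apply: measurable_coord_rV => //.
  exact: measurable_ball.
by apply/seteqP; split => v /=; [move=> h i _; exact: h|move=> h i; exact: h].
Qed.

Lemma open_measurable_rV (U : set 'rV[R]_n) : open U -> measurable U.
Proof.
move=> oU.
pose c (a : 'rV[rat]_n) : 'rV[R]_n := map_mx ratr a.
pose F (p : 'rV[rat]_n * rat) : set 'rV[R]_n :=
  if (0 < p.2) && `[< ball (c p.1) (ratr p.2) `<=` U >]
  then ball (c p.1) (ratr p.2) else set0.
suff -> : U = \bigcup_p F p.
  apply: countable_bigcupT_measurable; first exact: countableP.
  move=> p; rewrite /F; case: ifP => // /andP[p0 _].
  by apply: measurable_ball_rV; rewrite ltr0q.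
apply/seteqP; split=> [x Ux|x [p _]]; last first.
  by rewrite /F; case: ifP => // /andP[_ /asboolP]; apply.
have /nbhs_ballP[e /= e0 xeU] : nbhs x U by exact: open_nbhs_nbhs.
have [r /andP[r0 re]] : exists r : rat, (0 < ratr r :> R) && (ratr r < e / 2).
  have e20 : 0 < e / 2 by lra.
  have [r] := rat_in_itvoo e20.
  by rewrite in_itv/= => ?; exists r.
(* The rational centre is within [r] of [x] in each coordinate, so its ball of radius [r] contains
   [x] and lies in the ball about [x] of radius [2 r < e]. *)
have /choice[a ax] : forall i, exists a : rat, x ord0 i < ratr a < x ord0 i + ratr r.
  move=> i; have [|a] := @rat_in_itvoo R (x ord0 i) (x ord0 i + ratr r).
    by rewrite ltrDl.
  by rewrite in_itv/= => ?; exists a.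
have xB : ball (c (\row_i a i)) (ratr r) x.
  rewrite ball_rVE//= => i; rewrite !mxE; have /andP[? ?] := ax i.
  rewrite ltr_norml; apply/andP; split; lra.
exists (\row_i a i, r) => //; rewrite /F /= -(@ltr0q R) r0/=.
rewrite asboolT// => y yB.
apply: xeU; apply: (@le_ball _ _ _ (ratr r + ratr r)); first lra.
by apply: ball_triangle yB; exact: ball_sym.
Qed.

Lemma continuous_measurable_rV (f : 'rV[R]_n -> R) : continuous f ->
  measurable_fun setT f.
Proof.
move=> /continuousP cf; apply: (measurability _ (RGenOInfty.measurableE R)) => _ [_ [x ->] <-].
rewrite setTI; apply: open_measurable_rV; apply: cf; exact: interval_open.
Qed.

End continuous_measurable_rV.

(** * Rearrangements *)

Section monotone_measurable.
Context {R : realType}.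
Local Open Scope ereal_scope.

Lemma nonincreasing_emeasurable (h : R -> \bar R) :
  {homo h : s t / (s <= t)%R >-> t <= s} -> measurable_fun setT h.
Proof.
move=> hh; apply: (measurability _ (ErealGenOInfty.measurableE R)) => _ [_ [x ->] <-].
rewrite setTI; apply: is_interval_measurable => s t /=.
rewrite !in_itv/= !andbT => hs ht u /andP[su ut].
by rewrite in_itv/= andbT (lt_le_trans ht)// hh.
Qed.

End monotone_measurable.

Section rearrangement_theory.
Context d (T : measurableType d) (R : realType).
Variable mu : {measure set T -> \bar R}.
Implicit Type f : T -> R.
Local Open Scope ereal_scope.

Lemma rearrangement_ge0 f t : 0 <= rearrangement mu f t.
Proof. by apply: le_ereal_inf_tmp => _ /= [s [s0 _] <-]; rewrite lee_fin. Qed.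

Lemma rearrangement_le f t s : (0 <= s)%R ->
  mu [set x | (s < `|f x|)%R] <= t%:E -> rearrangement mu f t <= s%:E.
Proof. by move=> s0 st; apply: ereal_inf_lbound; exists s. Qed.

Lemma le_rearrangement f t L :
  (forall s, (0 <= s)%R -> mu [set x | (s < `|f x|)%R] <= t%:E -> L <= s%:E) ->
  L <= rearrangement mu f t.
Proof. by move=> h; apply: le_ereal_inf_tmp => _ /= [s [s0 st] <-]; exact: h. Qed.

Lemma rearrangement_nonincreasing f :
  {homo rearrangement mu f : s t / (s <= t)%R >-> t <= s}.
Proof.
move=> s t st; apply: le_rearrangement => r r0 rs; apply: rearrangement_le => //.
by rewrite (le_trans rs)// lee_fin.
Qed.

Lemma measurable_rearrangement f D : measurable_fun D (rearrangement mu f).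
Proof.
apply: (@measurable_funS _ _ _ _ setT) => //.
by apply: nonincreasing_emeasurable; exact: rearrangement_nonincreasing.
Qed.

Lemma distribution_nonincreasing f : measurable_fun setT f ->
  {homo (fun s => mu [set x | (s < f x)%R]) : s t / (s <= t)%R >-> t <= s}.
Proof.
move=> mf s t st.
have mfs r : measurable [set x | (r < f x)%R].
  rewrite [X in measurable X](_ : _ = setT `&` f @^-1` `]r, +oo[%classic); first exact: mf.
  by rewrite setTI; apply/seteqP; split=> x /=; rewrite in_itv/= andbT.
by apply: le_measure; rewrite ?inE//= => x /=; exact: le_lt_trans.
Qed.

(** Every level [s] admissible in the infimum defining the rearrangement confines the set on the
    left to [[0, s]]. This turns an integral over levels into [g^* t] at the end of the ray
    estimate. *)
Lemma lebesgue_distribution_le f t : measurable_fun setT f -> (forall x, 0 <= f x)%R ->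
  @lebesgue_measure R [set s | (0 <= s)%R /\ t%:E < mu [set x | (s < f x)%R]]
  <= rearrangement mu f t.
Proof.
move=> mf f0; apply: le_rearrangement => s s0 st.
have -> : s%:E = @lebesgue_measure R `[0%R, s]%classic.
  rewrite lebesgue_measure_itv/= lte_fin; case: ltP => [_|s0']; first by rewrite -EFinD subr0.
  by congr EFin; apply/le_anti; rewrite s0 s0'.
apply: le_measure; rewrite ?inE//.
  apply: is_interval_measurable => a b /= [a0 ha] [b0 hb] c /andP[ac cb]; split.
    exact: le_trans ac.
  by rewrite (lt_le_trans hb)// distribution_nonincreasing.
move=> r /= [r0 hr]; rewrite in_itv/= r0/= leNgt; apply/negP => sr.
move: hr; apply/negP; rewrite -leNgt (le_trans _ st)//.
rewrite (_ : [set x | (s < `|f x|)%R] = [set x | (s < f x)%R]).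
  by apply: distribution_nonincreasing => //; exact: ltW.
by apply/seteqP; split=> x /=; rewrite ger0_norm.
Qed.

End rearrangement_theory.

Section indicator_integral.
Context d (T : measurableType d) (R : realType).
Variable mu : {measure set T -> \bar R}.
Local Open Scope ereal_scope.

Lemma integral_bool (f : T -> bool) : measurable_fun setT f ->
  \int[mu]_x ((f x)%:R : R)%:E = mu [set x | f x].
Proof.
move=> mf.
have mA : measurable [set x | f x].
  rewrite [X in measurable X](_ : _ = setT `&` f @^-1` [set true]); first exact: mf.
  by rewrite setTI; apply/seteqP; split=> x /=; case: (f x).
transitivity (\int[mu]_x (\1_[set x | f x] x)%:E); last by rewrite integral_indic// setIT.
apply: eq_integral => x _.
rewrite indicE; congr (_%:R%:E); case: (boolP (f x)) => fx; first by rewrite mem_set.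
by rewrite memNset//; exact/negP.
Qed.

End indicator_integral.

Section layer_cake.
Context d (T : measurableType d) (R : realType).
Variable mu : {sigma_finite_measure set T -> \bar R}.
Local Notation leb := (@lebesgue_measure R).
Local Open Scope ereal_scope.

(** Tonelli's theorem applied to the indicator of [0 <= s < f x]. *)
Lemma layer_cake (f : T -> R) : measurable_fun setT f -> (forall x, 0 <= f x)%R ->
  \int[mu]_x (f x)%:E =
  \int[leb]_s (if (0 <= s)%R then mu [set x | (s < f x)%R] else 0).
Proof.
move=> mf f0.
pose F (p : T * measurableTypeR R) : \bar R := ((((0 <= p.2) && (p.2 < f p.1))%R)%:R : R)%:E.
have mb : measurable_fun setT (fun p : T * measurableTypeR R => (0 <= p.2)%R && (p.2 < f p.1)%R).
  apply: measurable_and.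
    by apply: measurable_fun_ler => //; exact: measurable_snd.
  apply: measurable_fun_ltr; first exact: measurable_snd.
  by apply: measurableT_comp => //; exact: measurable_fst.
have mF : measurable_fun setT F.
  rewrite (_ : F = fun p => if (0 <= p.2)%R && (p.2 < f p.1)%R then 1 else 0).
    exact: measurable_fun_ifT.
  by apply/funext => p; rewrite /F; case: ifP.
have F0 p : 0 <= F p by rewrite lee_fin.
transitivity (\int[mu]_x \int[leb]_s F (x, s)).
  apply: eq_integral => x _; rewrite /F /= integral_bool; last exact: (measurable_fun_pair2 x mb).
  rewrite (_ : [set _ | _] = `[0%R, f x[%classic).
    rewrite [RHS]lebesgue_measure_itv/= lte_fin; case: ltP => [_|fx0]; first by rewrite -EFinD subr0.
    by congr EFin; apply/le_anti; rewrite f0 fx0.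
  by apply/seteqP; split=> s /=; rewrite in_itv.
rewrite fubini_tonelli//; apply: eq_integral => s _; rewrite /F /=.
case: ifPn => s0 /=; last by rewrite integral0.
by rewrite (@integral_bool _ _ _ mu (fun x => s < f x)%R)//; exact: measurable_fun_ltr.
Qed.

End layer_cake.

(** * Averaging over rays *)

Section power_integrals.
Context {R : realType}.
Local Notation leb := (@lebesgue_measure R).

Lemma integral_invX (a : R) n : 0 < a ->
  (\int[leb]_(x in `[a, +oo[) (x^-1 ^+ n.+2)%:E = (a^-1 ^+ n.+1 / n.+1%:R)%:E)%E.
Proof.
move=> a0.
have a_neq0 x : a <= x -> x != 0 by move=> ax; rewrite gt_eqF// (lt_le_trans a0).
pose F (x : R) : R := - (x^-1 ^+ n.+1 / n.+1%:R).
have dF (x : R) : a <= x -> is_derive x 1 F (x^-1 ^+ n.+2).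
  move=> ax; have x0 := a_neq0 _ ax.
  have dV : is_derive x 1 (fun y : R => y^-1) (- x^-1 ^+ 2).
    rewrite (_ : - x^-1 ^+ 2 = - x ^- 2 *: 1); last by rewrite scaler1 exprVn.
    exact: is_deriveV.
  have dX := is_deriveX n.+1 dV.
  have dZ := is_deriveZ (- n.+1%:R^-1) dX.
  have -> : F = - n.+1%:R^-1 \*: (GRing.inv : R -> R) ^+ n.+1.
    by apply/funext => y; rewrite /F /= exprfctE /GRing.scale/= mulNr mulrC.
  apply: (is_derive_eq dZ).
  rewrite /GRing.scale/= -[n.+2]addn2 exprD; set X := x^-1 ^+ n; set Y := x^-1 ^+ 2.
  by rewrite mulrN mulrNN !mulrA mulVf ?pnatr_eq0// mul1r.
have cf (x : R) : a <= x -> {for x, continuous (fun x : R => x^-1 ^+ n.+2)}.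
  by move=> ax; apply: (@continuous_comp _ _ _ (fun x : R => x^-1) (fun x => x ^+ n.+2));
    [exact/inv_continuous/a_neq0|exact: exprn_continuous].
rewrite (@ge0_continuous_FTC2y _ _ F a 0).
- by rewrite -EFinD /F opprK add0r.
- by move=> x ax; rewrite exprn_ge0// invr_ge0 ltW// (lt_le_trans a0).
- apply: continuous_in_subspaceT => x; rewrite inE/= in_itv/= andbT; exact: cf.
- rewrite -oppr0; apply: cvgN; rewrite -(mul0r n.+1%:R^-1); apply: cvgMl.
  rewrite [X in _ --> X](_ : 0 = (0 : R) ^+ n.+1); last by rewrite expr0n.
  apply: (@cvg_comp _ _ _ (fun x : R => x^-1) (fun x => x ^+ n.+1)).
    by apply/gtr0_cvgV0 => //; exact: nbhs_pinfty_gt.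
  exact: exprn_continuous.
- by move=> x ax; apply: ex_derive; apply: dF; exact: ltW.
- apply: cvg_at_right_filter; apply: differentiable_continuous.
  by apply/derivable1_diffP/ex_derive; exact: dF.
- by move=> x; rewrite in_itv/= andbT => ax; rewrite derive1E; have dx := dF x (ltW ax);
  rewrite derive_val.
Qed.

Lemma powR_invnK (m : R) n : 0 <= m -> (m `^ n.+1%:R^-1) ^+ n.+1 = m.
Proof.
move=> m0; rewrite -powR_mulrn ?powR_ge0// -powRrM mulVf ?pnatr_eq0//.
by rewrite powRr1.
Qed.

Lemma measurable_invX n : measurable_fun setT (fun t : R => t^-1 ^+ n).
Proof.
apply: measurable_funX.
(* This form reduces the inverse to a real power of a nonnegative number; at 0 both sides are 0. *)
rewrite (_ : GRing.inv = fun t : R => t * (t ^+ 2) `^ (- 1)).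
  apply: measurable_funM => //.
  exact: (measurableT_comp (measurable_powR (-1)) (measurable_funX 2 (@measurable_id _ R setT))).
apply/funext => t; rewrite powRN powRr1 ?sqr_ge0//.
have [->|t0] := eqVneq t 0; first by rewrite mul0r invr0.
by field.
Qed.

(** The two terms of the minimum meet at [a = m^(1/d)] with [d = n.+2]. The part below [a]
    contributes at most [a]; the tail contributes [a^d a^(1-d) / (d-1) = a / (d-1)]. *)
Lemma integral_min_le (m : R) n : 0 <= m ->
  (\int[leb]_t (if 0 < t then Num.min 1 (t^-1 ^+ n.+2 * m) else 0)%:E <=
   ((1 + n.+1%:R^-1) * m `^ n.+2%:R^-1)%:E)%E.
Proof.
rewrite le_eqVlt => /predU1P[<-|m0].
  rewrite integral0_eq ?lee_fin ?mulr_ge0 ?powR_ge0 ?addr_ge0// => t _.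
  by case: ifP => //; rewrite mulr0 minEle ler10.
set a := m `^ _; have a0 : 0 < a by rewrite powR_gt0.
have am : a ^+ n.+2 = m by rewrite powR_invnK// ltW.
pose g (t : R) : \bar R := (t^-1 ^+ n.+2 * m)%:E.
have mg : measurable_fun setT g.
  by apply/measurable_EFinP; apply: measurable_funM => //; exact: measurable_invX.
have g0 t : `[a, +oo[%classic t -> (0 <= g t)%E.
  rewrite /= in_itv/= andbT => ta.
  by rewrite lee_fin mulr_ge0 ?(ltW m0)// exprn_ge0// invr_ge0 ltW// (lt_le_trans a0).
apply: (@le_trans _ _ (\int[leb]_t ((\1_`]0%R, a]%classic t)%:E + (g \_ `[a, +oo[%classic) t))%E).
  apply: ge0_le_integral => //.
  - move=> t _; rewrite lee_fin; case: ifP => // t0.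
    by rewrite le_min ler01 mulr_ge0 ?(ltW m0)// exprn_ge0// invr_ge0 ltW.
  - apply/measurable_EFinP; apply: measurable_fun_ifT => //.
      exact: measurable_fun_ltr.
    apply: measurable_minr => //; apply: measurable_funM => //; exact: measurable_invX.
  - apply: emeasurable_funD; first exact/measurable_EFinP.
    by apply/(measurable_restrictT _ _).1 => //; exact: measurable_funS mg.
  - move=> t _; rewrite patchE indicE.
    case: ifP => t0; last first.
      by rewrite adde_ge0 ?lee_fin//; case: ifPn => // /set_mem; exact: g0.
    case: (leP t a) => ta.
      rewrite mem_set/= ?in_itv/= ?t0//.
      apply: (@le_trans _ _ 1%E); first by rewrite lee_fin ge_min lexx.
      by rewrite leeDl//; case: ifPn => // /set_mem; exact: g0.
    rewrite memNset; last by rewrite /= in_itv/= t0/= leNgt ta.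
    by rewrite mem_set/= ?in_itv/= ?(ltW ta)// add0e lee_fin ge_min lexx orbT.
rewrite ge0_integralD//; last 3 first.
- exact/measurable_EFinP.
- by move=> t _; rewrite patchE; case: ifPn => // /set_mem; exact: g0.
- by apply/(measurable_restrictT _ _).1 => //; exact: measurable_funS mg.
rewrite integral_indic// setIT [X in (X + _)%E](lebesgue_measure_oc 0 a) a0 subr0.
rewrite -integral_mkcond.
have -> : (\int[leb]_(t in `[a, +oo[) g t = (a / n.+1%:R)%:E)%E.
  under eq_integral do rewrite /g mulrC EFinM.
  rewrite ge0_integralZl_EFin ?(ltW m0)//; last 2 first.
  - move=> t; rewrite /= in_itv/= andbT => ta.
    by rewrite lee_fin exprn_ge0// invr_ge0 ltW// (lt_le_trans a0).
  - apply/measurable_EFinP; apply: (measurable_funS _ _ (measurable_invX _)) => //.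
  rewrite integral_invX// -EFinM -am; congr EFin.
  by rewrite exprS !mulrA -(mulrA a) -exprMn divff ?gt_eqF// expr1n mulr1.
by rewrite -EFinD lee_fin mulrDl mul1r (mulrC a).
Qed.

(** The exponent [1/d - 1] is nonpositive, so on []0, m[] the integrand is at least [m^(1/d - 1)],
    over a length [m]. Replacing the power by an integral in [t] makes room for one more exchange of
    integrals. *)
Lemma powR_le_integral (m : R) n : 0 <= m ->
  ((m `^ n.+2%:R^-1)%:E <=
   \int[leb]_t (if (0 < t) && (t < m) then t `^ (n.+2%:R^-1 - 1) else 0)%:E)%E.
Proof.
move=> m0; set p := n.+2%:R^-1.
have p1 : p <= 1 by rewrite invf_le1// ler1n.
have pN0 : p != 0 by rewrite invr_eq0 pnatr_eq0.
apply: (@le_trans _ _ (\int[leb]_t (m `^ (p - 1) * \1_`]0%R, m[%classic t)%:E)%E).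
  under eq_integral do rewrite EFinM.
  rewrite ge0_integralZl_EFin ?powR_ge0//; last exact/measurable_EFinP.
  rewrite integral_indic// setIT [X in (_ * X)%E](_ : _ = m%:E); last first.
    rewrite [LHS]lebesgue_measure_itv/= lte_fin; case: ltP => [_|m0'].
      by rewrite -EFinD subr0.
    by congr EFin; apply/le_anti; rewrite m0 m0'.
  rewrite -EFinM lee_fin; move: m0; rewrite le_eqVlt => /predU1P[<-|m0].
    by rewrite mulr0 powR0.
  rewrite -[X in _ * X]powRr1 ?(ltW m0)// -powRD ?subrK//.
  by rewrite [m == 0]gt_eqF// implybT.
apply: ge0_le_integral => //.
- by move=> t _; rewrite lee_fin mulr_ge0// powR_ge0.
- by apply/measurable_EFinP; exact: measurable_funM.
- apply/measurable_EFinP; apply: measurable_fun_ifT => //.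
  by apply: measurable_and; exact: measurable_fun_ltr.
- move=> t _; rewrite lee_fin indicE; case: ifP => tm; last first.
    by rewrite memNset/= ?in_itv/= ?tm// mulr0.
  have /andP[t0 ltm] := tm.
  rewrite mem_set/= ?in_itv/= ?tm// mulr1.
  rewrite -[p - 1]opprB !powRN lef_pV2 ?posrE ?powR_gt0 ?(lt_trans t0 ltm)//.
  by apply: ge0_ler_powR; rewrite ?nnegrE ?subr_ge0 ?(ltW t0) ?(ltW ltm).
Qed.

End power_integrals.

Section averaged_rays.
Context {R : realType}.
Local Notation leb := (@lebesgue_measure R).
Local Open Scope ereal_scope.

(** Open at 0, so that every direction has positive coordinates and every ray leaves any bounded
    set. *)
Definition unit_box n : set 'rV[R]_n := @box R n `]0%R, 1%R]%classic.

Lemma lebesgue_unit_box n : leb_rV (@unit_box n) = 1.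
Proof.
rewrite /leb_rV lebesgue_rV_box// (lebesgue_measure_oc 0 1) ltr01 subr0.
by rewrite -EFin_expe expr1n.
Qed.

Variables (n : nat) (g : 'rV[R]_n.+2 -> R).
Hypotheses (mg : measurable_fun setT g) (g0 : forall x, (0 <= g x)%R).
Hypothesis gfin : forall s, (0 <= s)%R -> leb_rV [set x | (s < g x)%R] < +oo.
Let mu := @leb_rV R n.+2.
Let Q := @unit_box n.+2.
Let m s := mu [set x | (s < g x)%R].
(** A real-valued copy of [m] on nonnegative levels, where [gfin] guarantees finiteness; the value 0
    at negative levels allows integration over the whole line. *)
Let M (s : R) : R := (if 0 <= s then fine (m s) else 0)%R.

Let mQ : measurable Q. Proof. exact: measurable_box. Qed.

Let M0 s : (0 <= M s)%R.
Proof. by rewrite /M; case: ifP => // _; rewrite fine_ge0. Qed.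

Let ME s : (0 <= s)%R -> (M s)%:E = m s.
Proof. by move=> s0; rewrite /M s0 fineK// ge0_fin_numE// gfin. Qed.

Let mm (f : 'rV[R]_n.+2 -> R) : measurable_fun setT f ->
  measurable_fun setT (fun s : R => mu [set x | (s < f x)%R]).
Proof.
by move=> mf; exact: (nonincreasing_emeasurable (distribution_nonincreasing (@leb_rV R n.+2) mf)).
Qed.

Let mM : measurable_fun setT (M : measurableTypeR R -> R).
Proof.
apply: measurable_fun_ifT => //; first exact: measurable_fun_ler.
apply: (measurableT_comp (fine_measurable measurableT)).
exact: (mm mg).
Qed.

Let msup s : measurable [set y | (s < g y)%R].
Proof.
rewrite [X in measurable X](_ : _ = setT `&` g @^-1` `]s, +oo[%classic); first exact: mg.
by rewrite setTI; apply/seteqP; split=> y /=; rewrite in_itv/= andbT.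
Qed.

(** The bound 1 is the volume of [Q]; the other bound is the volume of the preimage of [{g > s}]
    under [w |-> x + t w]. *)
Let slice_le x t s : (0 < t)%R -> (0 <= s)%R ->
  mu [set w | (s < \1_Q w * g (x + t *: w))%R] <= (Num.min 1 (t^-1 ^+ n.+2 * M s)%R)%:E.
Proof.
move=> t0 s0.
have mT : measurable [set w | (s < g (x + t *: w))%R].
  have /= := measurable_affine_rV x t measurableT (msup s).
  by rewrite setTI.
have mI : measurable [set w | (s < \1_Q w * g (x + t *: w))%R].
  rewrite (_ : [set _ | _] = Q `&` [set w | (s < g (x + t *: w))%R]); first exact: measurableI.
  apply/seteqP; split=> w /=; rewrite indicE; case: (boolP (w \in Q)) => wQ.
  - by rewrite mul1r; split => //; exact/set_mem.
  - by rewrite mul0r ltNge s0.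
  - by rewrite mul1r => -[].
  - by move=> [/mem_set]; rewrite (negPf wQ).
rewrite EFin_min le_min; apply/andP; split.
  rewrite -(lebesgue_unit_box n.+2); apply: le_measure; rewrite ?inE//.
  move=> w /=; rewrite indicE; case: (boolP (w \in Q)) => [/set_mem//|_].
  by rewrite mul0r ltNge s0.
rewrite EFinM ME// -(lebesgue_rV_affine x t0 (msup s)); apply: le_measure; rewrite ?inE//.
move=> w /=; rewrite indicE; case: (boolP (w \in Q)) => _; rewrite ?mul1r//.
by rewrite mul0r ltNge s0.
Qed.

Let F x (p : 'rV[R]_n.+2 * measurableTypeR R) : \bar R :=
  (\1_Q p.1 * (if 0 < p.2 then g (x + p.2 *: p.1) else 0))%R%:E.

Let mF x : measurable_fun setT (F x).
Proof.
apply/measurable_EFinP; apply: measurable_funM.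
  exact: (measurableT_comp (measurable_indic mQ) measurable_fst).
apply: measurable_fun_ifT => //; first exact: measurable_fun_ltr.
apply: (measurableT_comp mg); apply: measurable_fun_rV => i.
rewrite (_ : _ \o _ = (fun p => x ord0 i + p.2 * @coord_rV _ R _ i p.1)%R).
  apply: measurable_funD => //; apply: measurable_funM => //.
  exact: (measurableT_comp (measurable_coord_rV i) measurable_fst).
by apply/funext => p; rewrite /= /coord_rV !mxE.
Qed.

Let F0 x p : 0 <= F x p.
Proof. by rewrite lee_fin mulr_ge0//; case: ifP. Qed.

Lemma averaged_rays_le x :
  \int[mu]_w \int[leb]_t (\1_Q w * (if 0 < t then g (x + t *: w) else 0))%R%:E <=
  (1 + n.+1%:R^-1)%:E * \int[leb]_(t in `]0%R, +oo[%classic)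
     ((t `^ (n.+2%:R^-1 - 1))%:E * rearrangement (lebesgue_rV n.+2) g t).
Proof.
set c := (1 + _)%R; have c0 : (0 <= c)%R by rewrite addr_ge0.
pose K (p : measurableTypeR R * measurableTypeR R) : \bar R :=
  (if 0 < p.1 then Num.min 1 (p.1^-1 ^+ n.+2 * M p.2) else 0)%R%:E.
have mK : measurable_fun setT K.
  apply/measurable_EFinP; apply: measurable_fun_ifT => //; first exact: measurable_fun_ltr.
  apply: measurable_minr => //; apply: measurable_funM.
    exact: (measurableT_comp (measurable_invX _) measurable_fst).
  exact: (measurableT_comp mM measurable_snd).
have K0 p : 0 <= K p.
  rewrite lee_fin; case: ifP => // t0.
  by rewrite le_min ler01 mulr_ge0// exprn_ge0// invr_ge0 ltW.
pose p : R := (n.+2%:R^-1 - 1)%R.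
pose H (q : measurableTypeR R * measurableTypeR R) : \bar R :=
  (if (0 < q.2) && (q.2 < M q.1) then q.2 `^ p else 0)%R%:E.
have mH : measurable_fun setT H.
  apply/measurable_EFinP; apply: measurable_fun_ifT => //.
    apply: measurable_and; first exact: measurable_fun_ltr.
    by apply: measurable_fun_ltr => //; exact: (measurableT_comp mM measurable_fst).
  exact: (measurableT_comp (measurable_powR _) measurable_snd).
have H0 q : 0 <= H q.
  by rewrite lee_fin; case: ifP => // _; exact: powR_ge0.
apply: (@le_trans _ _ (\int[leb]_t \int[leb]_s K (t, s))).
  (* First exchange: with [t] fixed, the layer cake formula applies to the integral in [w]. *)
  rewrite (@fubini_tonelli _ _ _ _ _ (@leb_rV R n.+2) leb (F x))//.
  apply: ge0_le_integral => //.
  - by move=> t _; apply: integral_ge0 => w _; exact: (F0 x).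
  - exact: (@measurable_fun_fubini_tonelli_G _ _ _ _ _ (@leb_rV R n.+2) (F x) (mF x) (F0 x)).
  - exact: (@measurable_fun_fubini_tonelli_F _ _ _ _ _ leb K mK K0).
  - move=> t _; rewrite /F /K /=; case t0 : (0 < t)%R; last first.
      by rewrite integral0_eq ?integral_ge0// => w _; rewrite mulr0.
    have mFt : measurable_fun setT (fun w => \1_Q w * g (x + t *: w))%R.
      apply: measurable_funM => //.
      exact: (measurableT_comp mg (measurable_affine_rV x t)).
    rewrite layer_cake//; last by move=> w; rewrite mulr_ge0.
    apply: ge0_le_integral => //.
    + by move=> s _; case: ifP.
    + apply: measurable_fun_ifT => //; first exact: measurable_fun_ler.
      exact: (mm mFt).
    + apply/measurable_EFinP; apply: measurable_minr => //.
      by apply: measurable_funM => //; exact: mM.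
    + move=> s _; case: ifPn => s0; first exact: slice_le.
      by rewrite lee_fin le_min ler01 mulr_ge0// exprn_ge0// invr_ge0 ltW.
(* Second exchange: with the level [s] fixed, the integral in [t] is that of [integral_min_le]. *)
rewrite fubini_tonelli//.
apply: (@le_trans _ _ (\int[leb]_s (c%:E * \int[leb]_t H (s, t)))).
  apply: ge0_le_integral => //.
  - by move=> s _; apply: integral_ge0 => t _; exact: K0.
  - exact: (@measurable_fun_fubini_tonelli_G _ _ _ _ _ leb K mK K0).
  - apply: measurable_funeM.
    exact: (@measurable_fun_fubini_tonelli_F _ _ _ _ _ leb H mH H0).
  - move=> s _; apply: (le_trans (integral_min_le n (M0 s))).
    by rewrite EFinM; apply: lee_wpmul2l => //; exact: powR_le_integral.
rewrite ge0_integralZl_EFin//; last 2 first.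
- by move=> s _; apply: integral_ge0 => t _; exact: H0.
- exact: (@measurable_fun_fubini_tonelli_F _ _ _ _ _ leb H mH H0).
apply: lee_wpmul2l => //.
(* Third exchange: with [t] fixed, the integral over levels [s] is the length of [{s | t < M s}],
   controlled by the rearrangement at [t]. *)
rewrite fubini_tonelli// [leRHS]integral_mkcond.
apply: ge0_le_integral => //.
- by move=> t _; apply: integral_ge0 => s _; exact: H0.
- exact: (@measurable_fun_fubini_tonelli_G _ _ _ _ _ leb H mH H0).
- apply/(measurable_restrictT _ _).1 => //; apply: emeasurable_funM.
    by apply/measurable_EFinP; apply: measurable_funS (measurable_powR _).
  exact: measurable_rearrangement.
- move=> t _; rewrite patchE; case: ifPn; last first.
    rewrite notin_setE/= in_itv/= andbT => /negP/negPf t0.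
    by rewrite integral0_eq// => s _; rewrite /H /= t0.
  rewrite inE/= in_itv/= andbT => t0.
  have -> : \int[leb]_s H (s, t) = \int[leb]_s ((t `^ p)%:E * ((t < M s)%R%:R : R)%:E).
    apply: eq_integral => s _; rewrite /H /= t0/= -EFinM.
    by case: ifP; rewrite ?mulr1 ?mulr0.
  have mb : measurable_fun setT (fun s : measurableTypeR R => (t < M s)%R).
    exact: measurable_fun_ltr.
  rewrite ge0_integralZl_EFin ?powR_ge0//; last first.
    rewrite (_ : (fun _ => _) = (fun s => if (t < M s)%R then 1 else 0)).
      exact: measurable_fun_ifT.
    by apply/funext => s; case: ifP.
  apply: lee_wpmul2l; first by rewrite lee_fin powR_ge0.
  rewrite (@integral_bool _ _ _ leb (fun s => t < M s)%R)//.
  apply: (le_trans _ (@lebesgue_distribution_le _ _ R (lebesgue_rV n.+2) g t mg g0)).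
  (* The two sets of levels coincide: [M] vanishes at negative [s], and [0 < t] excludes those. *)
  rewrite [leRHS](_ : _ = leb [set s | (t < M s)%R])//; congr leb.
  apply/esym/seteqP; split=> s /=.
    case: (leP 0%R s) => s0; last by rewrite /M leNgt s0/= ltNge (ltW t0).
    by rewrite -lte_fin ME.
  by move=> [s0]; rewrite -[X in _ < X](ME s0) lte_fin.
Qed.

(** Since the box has mass 1, a lower bound valid along every ray is also one for the average. *)
Lemma ray_bound x (a : R) :
  (forall w, unit_box w ->
     a%:E <= \int[leb]_t (if 0 < t then g (x + t *: w) else 0)%R%:E) ->
  (0 <= a)%R ->
  a%:E <= (1 + n.+1%:R^-1)%:E * \int[leb]_(t in `]0%R, +oo[%classic)
     ((t `^ (n.+2%:R^-1 - 1))%:E * rearrangement (lebesgue_rV n.+2) g t).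
Proof.
move=> aw a0; apply: le_trans (averaged_rays_le x).
have -> : a%:E = \int[mu]_w (a%:E * (\1_Q w)%:E).
  rewrite ge0_integralZl_EFin//; last exact/measurable_EFinP.
  rewrite integral_indic// setIT [X in _ * X](_ : _ = 1) ?mule1//.
  exact: lebesgue_unit_box.
apply: ge0_le_integral => //.
- by move=> w _; rewrite -EFinM lee_fin mulr_ge0.
- apply: measurable_funeM; exact/measurable_EFinP.
- exact: (@measurable_fun_fubini_tonelli_F _ _ _ _ _ leb (F x) (mF x) (F0 x)).
- move=> w _; rewrite indicE; case: (boolP (w \in Q)) => wQ; last first.
    rewrite mule0; apply: integral_ge0 => t _.
    by rewrite lee_fin mulr_ge0//; case: ifP.
  rewrite mule1; under eq_integral do rewrite mul1r.
  exact/aw/set_mem.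
Qed.

End averaged_rays.

(** * Directional derivatives and the sup bound *)

Section directional_derivative.
Context {R : realType} {V : normedModType R}.
Implicit Types (u : V -> R) (x y v w : V).

(* Strict differentiability along one direction: unlike the plain directional
   derivative, it is additive in the direction. *)
Definition strict_derive u y v (L : R) := forall e : R, 0 < e ->
  exists2 d : R, 0 < d & forall z (h : R), `|z - y| < d -> `|h| < d ->
    `|u (z + h *: v) - u z - h * L| <= e * `|h|.

Lemma is_derive_line u x v (t : R) : derivable u (x + t *: v) v ->
  is_derive t 1 (fun s : R => u (x + s *: v)) ('D_v u (x + t *: v)).
Proof.
have E : (fun h : R => h^-1 *: ((fun s : R => u (x + s *: v)) (h *: 1 + t) - u (x + t *: v))) =
    (fun h : R => h^-1 *: (u (h *: v + (x + t *: v)) - u (x + t *: v))).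
  by apply/funext => h; rewrite scaler1 scalerDl addrCA.
move=> du; apply: DeriveDef; first by rewrite /derivable E.
by rewrite /derive E.
Qed.

Lemma mean_value (f df : R -> R) (h : R) : (forall s : R, is_derive s 1 f (df s)) ->
  exists2 c : R, `|c| <= `|h| & f h - f 0 = h * df c.
Proof.
move=> fdf.
have cf A : {within A, continuous f}.
  apply: continuous_subspaceT => s; apply: differentiable_continuous.
  by apply/derivable1_diffP; exact: ex_derive.
case: (leP 0 h) => h0.
  have [c] := MVT_segment h0 (fun s _ => fdf s) (cf _).
  rewrite in_itv/= => /andP[c0 ch] ->; exists c; last by rewrite subr0 mulrC.
  by rewrite !ger0_norm.
have [c] := MVT_segment (ltW h0) (fun s _ => fdf s) (cf _).
rewrite in_itv/= sub0r => /andP[hc c0] e; exists c.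
  by rewrite ler0_norm// ltr0_norm// lerN2.
by rewrite -opprB e mulrN opprK mulrC.
Qed.

(** The mean value theorem turns the difference quotient based at [z] into a value of the derivative
    at a nearby point; continuity at [y] makes this uniform in [z]. *)
Lemma strict_derive_continuous u v y :
  (forall z, derivable u z v) -> {for y, continuous ('D_v u)} ->
  strict_derive u y v ('D_v u y).
Proof.
move=> du cu e e0.
have /cvgrPdist_lt/(_ _ e0)/nbhs_ballP[d /= d0 hd] := cu.
have v1 : 0 < 1 + `|v| by rewrite ltr_pwDl.
(* With this radius the intermediate point [z + c *: v] stays within [d] of [y], as
   [|z - y| + |c| |v| < d]; the added 1 also covers [v = 0]. *)
exists (d / (1 + `|v|)); first by rewrite divr_gt0.
move=> z h zy hd'.
have [s|c ch] := @mean_value (fun s => u (z + s *: v)) (fun s => 'D_v u (z + s *: v)) h.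
  exact: is_derive_line.
rewrite scale0r addr0 => ->.
rewrite -mulrBr normrM mulrC ler_wpM2r// distrC ltW//; apply: hd.
rewrite -ball_normE/= distrC.
rewrite (_ : z + c *: v - y = (z - y) + c *: v); last by rewrite addrAC.
rewrite (le_lt_trans (ler_normD _ _))// normrZ.
move: zy hd'; rewrite !ltr_pdivlMr// => zy hd'.
have cd : `|c| * (1 + `|v|) < d by rewrite (le_lt_trans _ hd')// ler_wpM2r// ltW.
have := normr_ge0 v; have := normr_ge0 c; have := normr_ge0 (z - y).
nra.
Qed.

Lemma strict_derive0 u y : strict_derive u y 0 0.
Proof.
move=> e e0; exists 1 => // z h _ _.
by rewrite scaler0 addr0 subrr mulr0 subrr normr0 mulr_ge0// ltW.
Qed.

Lemma strict_deriveZ u y v L (c : R) :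
  strict_derive u y v L -> strict_derive u y (c *: v) (c * L).
Proof.
move=> uL e e0.
have c1 : 0 < 1 + `|c| by rewrite ltr_pwDl.
have [d d0 hd] := uL _ (divr_gt0 e0 c1).
exists (d / (1 + `|c|)); first by rewrite divr_gt0.
move=> z h; rewrite !ltr_pdivlMr// => zy hh.
have c0 := normr_ge0 c; have h0 := normr_ge0 h; have z0 := normr_ge0 (z - y).
rewrite scalerA mulrA (le_trans (hd z (h * c) _ _))//.
- by apply: le_lt_trans zy; nra.
- by rewrite normrM; apply: le_lt_trans hh; nra.
rewrite normrM mulrAC ler_pdivrMr//.
have : 0 <= e * `|h| by rewrite mulr_ge0// ltW.
nra.
Qed.

(** The increment is split at [z + h *: v]. The second half is based at this moving point, which is
    why the definition is uniform in [z]. *)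
Lemma strict_deriveD u y v w L K :
  strict_derive u y v L -> strict_derive u y w K -> strict_derive u y (v + w) (L + K).
Proof.
move=> uL uK e e0.
have e20 : 0 < e / 2 by rewrite divr_gt0.
have [d1 d10 h1] := uL _ e20; have [d2 d20 h2] := uK _ e20.
have v1 : 0 < 1 + `|v| by rewrite ltr_pwDl.
exists (Num.min d1 (d2 / (1 + `|v|))); first by rewrite lt_min d10 divr_gt0.
move=> z h; rewrite !lt_min !ltr_pdivlMr// => /andP[zy1 zy2] /andP[hh1 hh2].
have v0 := normr_ge0 v; have h0 := normr_ge0 h; have z0 := normr_ge0 (z - y).
have zv : `|z + h *: v - y| < d2.
  rewrite (_ : z + h *: v - y = (z - y) + h *: v); last by rewrite addrAC.
  rewrite (le_lt_trans (ler_normD _ _))// normrZ.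
  by case: (leP `|z - y| `|h|) => zh; nra.
have hd2 : `|h| < d2 by apply: le_lt_trans hh2; nra.
have A := h1 z h zy1 hh1; have B := h2 (z + h *: v) h zv hd2.
rewrite scalerDr addrA.
rewrite (_ : _ - _ = (u (z + h *: v) - u z - h * L) +
  (u (z + h *: v + h *: w) - u (z + h *: v) - h * K)); last by ring.
by rewrite (le_trans (ler_normD _ _))// [e]splitr mulrDl lerD.
Qed.

Lemma is_derive_strict u x v (t L : R) : strict_derive u (x + t *: v) v L ->
  is_derive t 1 (fun s : R => u (x + s *: v)) L.
Proof.
move=> uL.
suff h : (fun h : R => h^-1 *: ((fun s : R => u (x + s *: v)) (h *: 1 + t) - u (x + t *: v))) @ 0^' --> L.
  apply: DeriveDef; first by apply/cvg_ex; exists L.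
  exact: cvg_lim h.
apply/cvgrPdist_le => e e0.
have [d d0 hd] := uL _ e0.
near=> h.
have h0 : h != 0 by near: h; exact: nbhs_dnbhs_neq.
have hd' : `|h| < d by near: h; exact: dnbhs0_lt.
have := hd (x + t *: v) h; rewrite subrr normr0 => /(_ d0 hd').
rewrite scaler1 (_ : x + (h + t) *: v = x + t *: v + h *: v); last first.
  by rewrite scalerDl (addrC (h *: v)) addrA.
move: (u _ - u _) => A H; rewrite distrC.
rewrite (_ : h^-1 *: A - L = h^-1 * (A - h * L)); last by rewrite /GRing.scale/=; field.
by rewrite normrM normfV mulrC ler_pdivrMr ?normr_gt0.
Unshelve. all: by end_near. Qed.

End directional_derivative.

Lemma continuous_sum (R : realType) (T : topologicalType) (I : finType) (f : I -> T -> R) :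
  (forall i, continuous (f i)) -> continuous (fun x => \sum_i f i x).
Proof.
move=> cf x; apply: (@cvg_big _ _ +%R 0 xpredT); first exact: add_continuous.
by move=> i _; exact: cf.
Qed.

Section ray_estimate.
Context {R : realType} {n : nat}.
Implicit Types (u : 'rV[R]_n -> R) (x y v w : 'rV[R]_n).
Local Notation leb := (@lebesgue_measure R).

Lemma strict_derive_rV u y v :
  (forall i z, derivable u z (delta_mx ord0 i)) ->
  (forall i, continuous (partial i u)) ->
  strict_derive u y v (\sum_i v ord0 i * partial i u y).
Proof.
move=> du cu; rewrite [v in strict_derive _ _ v _]row_sum_delta.
apply: (big_ind2 (strict_derive u y)).
- exact: strict_derive0.
- by move=> *; exact: strict_deriveD.
- move=> i _; apply: strict_deriveZ; apply: strict_derive_continuous; first exact: du.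
  exact: cu.
Qed.

Lemma coord_le_eucl_norm x i : `|x ord0 i| <= eucl_norm x.
Proof.
rewrite -sqrtr_sqr /eucl_norm ler_wsqrtr// (bigD1 i)//= lerDl.
by apply: sumr_ge0 => j _; exact: sqr_ge0.
Qed.

Lemma eucl_norm_ge0 x : 0 <= eucl_norm x. Proof. exact: sqrtr_ge0. Qed.

Lemma continuous_eucl_norm : continuous (@eucl_norm R n).
Proof.
move=> x; apply: (@continuous_comp _ _ _ (fun x => \sum_i x ord0 i ^+ 2) Num.sqrt).
  move: x; apply: continuous_sum => i x.
  apply: (@continuous_comp _ _ _ (fun x : 'rV[R]_n => x ord0 i) (fun t => t ^+ 2)).
    exact: coord_continuous.
  exact: exprn_continuous.
exact: sqrt_continuous.
Qed.

Lemma continuous_eucl_norm_grad u : (forall i, continuous (partial i u)) ->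
  continuous (fun x => eucl_norm (grad u x)).
Proof.
move=> cu; rewrite (_ : (fun _ => _) = (fun x => Num.sqrt (\sum_i partial i u x ^+ 2))).
  move=> x; apply: (@continuous_comp _ _ _ (fun x => \sum_i partial i u x ^+ 2) Num.sqrt).
    move: x; apply: continuous_sum => i x.
    by apply: (@continuous_comp _ _ _ (partial i u) (fun t => t ^+ 2)); [exact: cu|exact: exprn_continuous].
  exact: sqrt_continuous.
by apply/funext => x; rewrite /eucl_norm; under eq_bigr do rewrite mxE.
Qed.

Lemma continuous_line x w : continuous (fun t : R => x + t *: w).
Proof.
move=> t; apply: cvgD; first exact: cvg_cst.
by apply: cvgZl; exact: cvg_id.
Qed.

(** The fundamental theorem of calculus on [[0, T]]. The factor [n] arises because the derivative
    along [w] is a sum of [n] terms, each at most [|grad u|] as the coordinates of [w] lie in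
    [[0, 1]]. *)
Lemma ray_ftc u x w (T : R) :
  (forall i z, derivable u z (delta_mx ord0 i)) ->
  (forall i, continuous (partial i u)) ->
  (forall i, 0 <= w ord0 i <= 1) -> 0 < T -> u (x + T *: w) = 0 ->
  (`|u x|%:E <= n%:R%:E * \int[leb]_t
     (if 0 < t then eucl_norm (grad u (x + t *: w)) else 0)%:E)%E.
Proof.
move=> du cu w01 T0 uT.
pose f (t : R) := u (x + t *: w).
pose df (t : R) := \sum_i w ord0 i * partial i u (x + t *: w).
have fdf (t : R) : is_derive t 1 f (df t).
  exact/is_derive_strict/strict_derive_rV.
have cf : continuous f.
  move=> t; apply: differentiable_continuous.
  by apply/derivable1_diffP; exact: ex_derive.
have cdf : continuous df.
  apply: continuous_sum => i t; apply: cvgM; first exact: cvg_cst.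
  apply: (@continuous_comp _ _ _ (fun t : R => x + t *: w) (partial i u)).
    exact: continuous_line.
  exact: cu.
pose g t := eucl_norm (grad u (x + t *: w)).
have mg : measurable_fun setT g.
  apply: continuous_measurable_fun => t.
  apply: (@continuous_comp _ _ _ (fun t : R => x + t *: w) (fun y => eucl_norm (grad u y))).
    exact: continuous_line.
  exact: continuous_eucl_norm_grad.
have mdf : measurable_fun setT df by exact: continuous_measurable_fun.
have dfg t : `|df t| <= n%:R * g t.
  rewrite (le_trans (ler_norm_sum _ _ _))//.
  rewrite (@le_trans _ _ (\sum_(i < n) g t))//; last by rewrite sumr_const card_ord mulr_natl.
  apply: ler_sum => i _; rewrite normrM.
  have /andP[w0 w1] := w01 i.
  rewrite (@le_trans _ _ (`|grad u (x + t *: w) ord0 i|)) ?coord_le_eucl_norm//.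
  by rewrite mxE ger0_norm// ler_piMl.
have FTC : (\int[leb]_(t in `[0%R, T]) (df t)%:E = (f T)%:E - (f 0)%:E)%E.
  apply: continuous_FTC2 => //.
  - exact: continuous_subspaceT.
  - split; first by move=> t _; exact: ex_derive.
    + exact/cvg_at_right_filter/cf.
    + exact/cvg_at_left_filter/cf.
  - by move=> t _; rewrite derive1E derive_val.
rewrite /f uT scale0r addr0 sub0e in FTC.
have -> : `|u x|%:E = (`|\int[leb]_(t in `[0%R, T]) (df t)%:E|)%E.
  by rewrite FTC abseN.
apply: (le_trans (le_abse_integral _ _ _)) => //.
  by apply/measurable_EFinP; exact: measurable_funS mdf.
rewrite -ge0_integralZl_EFin//; last 2 first.
- by move=> t _; case: ifP; rewrite lee_fin// => _; exact: eucl_norm_ge0.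
- apply/measurable_EFinP; apply: measurable_fun_ifT => //; exact: measurable_fun_ltr.
rewrite -integral_itv_obnd_cbnd; last first.
  apply: (measurable_funS _ (subsetT _)) => //; apply: measurableT_comp => //.
  exact/measurable_EFinP.
rewrite [leLHS]integral_mkcond; apply: ge0_le_integral => //.
- by move=> t _; rewrite patchE; case: ifPn.
- apply/(measurable_restrictT _ _).1 => //.
  apply: (measurable_funS _ (subsetT _)) => //; apply: measurableT_comp => //.
  exact/measurable_EFinP.
- apply: measurable_funeM; apply/measurable_EFinP.
  by apply: measurable_fun_ifT => //; exact: measurable_fun_ltr.
- move=> t _; rewrite patchE; case: ifPn => [|_].
    by rewrite inE/= in_itv/= => /andP[-> _]; rewrite -EFinM lee_fin.
  by rewrite mule_ge0// lee_fin; case: ifP => // _; exact: eucl_norm_ge0.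
Qed.

End ray_estimate.

Section sup_bound.
Context {R : realType} {n : nat}.
Local Notation d := (n.+2).
Local Notation leb := (@lebesgue_measure R).
Implicit Types (u : 'rV[R]_d -> R) (x y w : 'rV[R]_d).

Lemma test_function_bounded_support u : test_function u ->
  exists2 B : R, 0 < B & forall x i, B < `|x ord0 i| -> u x = 0 /\ grad u x = 0.
Proof.
move=> [_ /compact_bounded[B [_ hB]]].
pose B1 := Num.max B 0 + 1.
have B10 : 0 < B1 by rewrite ltr_wpDl// le_max lexx orbT.
have BB1 : B < B1 by rewrite ltr_pwDr// le_max lexx.
exists B1 => // x i xi.
have xS : ~ closure [set x | u x != 0] x.
  move=> /(hB _ BB1) xB; move: xi; apply/negP; rewrite -leNgt (le_trans _ xB)//.
  rewrite -[leRHS]/(mx_norm x) mx_normrE.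
  by rewrite (le_trans _ (le_bigmax _ _ (ord0, i))).
(* Vanishing at [x] alone would say nothing about the gradient; off the closed support, [u] vanishes
   in a neighbourhood. *)
have near0 : \forall y \near x, u y = 0.
  have : nbhs x (~` closure [set x | u x != 0]).
    by apply: open_nbhs_nbhs; split => //; rewrite openC; exact: closed_closure.
  apply: filterS => y yS; apply/eqP/negPn/negP => uy.
  by apply: yS; exact: subset_closure.
split; first exact: nbhs_singleton near0.
apply/rowP => j; rewrite !mxE /partial (@near_eq_derive _ _ _ u (cst 0)).
  exact: derive_cst.
exact: near0.
Qed.

Lemma lebesgue_rV_box_fin (m : nat) (a b : R) : a <= b ->
  lebesgue_rV m (@box R m `]a, b]%classic) = ((b - a) ^+ m)%:E.
Proof.
move=> ab; rewrite lebesgue_rV_box// lebesgue_measure_oc EFin_expe.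
case: ltP => // ba; have -> : a = b by apply/le_anti; rewrite ab ba.
by rewrite subrr.
Qed.

(** Origin of the constant: the first [d] comes from [ray_ftc], [1 + 1/(d-1)] from
    [integral_min_le], and the last [d] undoes the factor [b / a = 1/d] in the Lorentz norm. *)
Lemma test_function_sup_bound u x : test_function u ->
  (`|u x|%:E <= (d%:R * (1 + n.+1%:R^-1) * d%:R)%:E *
     lorentz_norm (lebesgue_rV d) d%:R 1 (fun x => eucl_norm (grad u x)))%E.
Proof.
move=> tu; have [B B0 hB] := test_function_bounded_support tu.
have du i z : derivable u z (delta_mx ord0 i) by have [_] := tu.1 [::]; exact.
have cu i : continuous (partial i u) by have [] := tu.1 [:: i].
pose g x := eucl_norm (grad u x).
have g0 y : 0 <= g y by exact: eucl_norm_ge0.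
have mg : measurable_fun setT g.
  by apply: continuous_measurable_rV; exact: continuous_eucl_norm_grad.
have gfin s : 0 <= s -> (leb_rV [set y | (s < g y)%R] < +oo)%E.
  move=> s0; apply: (@le_lt_trans _ _ (leb_rV (@box R d `](- B - 1), B]%classic))).
    apply: le_measure; rewrite ?inE; [|exact: measurable_box|].
      rewrite [X in measurable X](_ : _ = setT `&` g @^-1` `]s, +oo[%classic); first exact: mg.
      by rewrite setTI; apply/seteqP; split=> y /=; rewrite in_itv/= andbT.
    move=> y /= sy i; rewrite /= in_itv/=.
    case: (leP `|y ord0 i| B) => [|/hB[_ gy]].
      by rewrite ler_norml => /andP[? ?]; apply/andP; split; lra.
    move: sy; rewrite /g gy /eucl_norm big1 ?sqrtr0; first by rewrite ltNge s0.
    by move=> j _; rewrite mxE expr0n.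
  by rewrite [ltLHS]lebesgue_rV_box_fin ?ltry//; lra.
have ray w : unit_box w -> ((`|u x| / d%:R)%:E <=
    \int[leb]_t (if 0 < t then g (x + t *: w) else 0)%:E)%E.
  move=> Qw.
  have w0 : 0 < w ord0 ord0 by have := Qw ord0; rewrite /= in_itv/= => /andP[].
  (* At this time coordinate 0 of the ray equals [x_0 + B + |x_0| + 1 > B], outside the support. *)
  have T0 : 0 < (B + `|x ord0 ord0| + 1) / w ord0 ord0.
    by rewrite divr_gt0// ltr_wpDl// addr_ge0// ltW.
  set T := (_ / _) in T0.
  rewrite mulrC EFinM lee_pdivrMl ?ltr0n//; apply: (@ray_ftc R d u x w T) => //.
    by move=> i; have := Qw i; rewrite /= in_itv/= => /andP[/ltW-> ->].
  apply: (proj1 (hB _ ord0 _)); rewrite !mxE /T divfK ?gt_eqF//.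
  have := ler_norm (- x ord0 ord0); rewrite normrN => xN.
  by rewrite (lt_le_trans _ (ler_norm _))//; lra.
have a0 : 0 <= `|u x| / d%:R by rewrite divr_ge0.
have := ray_bound mg g0 gfin ray a0.
rewrite mulrC EFinM lee_pdivrMl ?ltr0n// => /le_trans; apply.
rewrite (EFinM (d%:R * _) d%:R) (EFinM d%:R (1 + _)) -!muleA.
apply: lee_wpmul2l => //; apply: lee_wpmul2l; first by rewrite lee_fin addr_ge0.
have nn : (0 <= \int[leb]_(t in `]0%R, +oo[)
    ((t `^ (d%:R^-1 - 1))%:E * rearrangement (lebesgue_rV d) g t))%E.
  by apply: integral_ge0 => t _; rewrite mule_ge0 ?lee_fin ?powR_ge0 ?rearrangement_ge0.
have E : (\int[leb]_(t in `]0%R, +oo[)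
    (((t `^ d%:R^-1)%:E * rearrangement (lebesgue_rV d) g t) `^ 1 * (t^-1)%:E) =
  \int[leb]_(t in `]0%R, +oo[)
    ((t `^ (d%:R^-1 - 1))%:E * rearrangement (lebesgue_rV d) g t))%E.
  apply: eq_integral => t; rewrite inE/= in_itv/= andbT => t0.
  rewrite poweRe1; last by rewrite mule_ge0 ?lee_fin ?powR_ge0 ?rearrangement_ge0.
  rewrite muleAC -EFinM powRD ?powR_inv1 ?(ltW t0)//.
  by rewrite [t == 0]gt_eqF// implybT.
rewrite /lorentz_norm /= E invr1 poweRe1; last by rewrite mule_ge0// lee_fin divr_ge0.
by rewrite muleA -EFinM mulrA mulr1 divff// mul1e.
Qed.

End sup_bound.

(** * From the supremum to the weighted weak norm *)

Section weak_type.
Context {R : realType} {n : nat}.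
Local Notation d := (n.+1).
Implicit Types (u : 'rV[R]_d -> R).

Lemma lorentz_weak_le u (q M : R) : measurable_fun setT u -> 0 < q -> 0 <= M -> (forall x, `|u x| <= M) ->
  (lorentz_norm (lebesgue_rV d) q +oo (fun x => eucl_norm x `^ (- (d%:R / q)) * u x)%R
   <= ((2 ^+ d) `^ q^-1 * M)%:E)%E.
Proof.
move=> mu q0 M0 uM; apply: ge_ereal_sup => _ /= [t + <-]; rewrite in_itv/= andbT => t0.
(* With [r = t^(1/d) / 2] as below, [a = r^(d/q)]. Where the weighted function exceeds [M / a] one
   has [|x| < r], and the cube of half-side [r] has volume exactly [t]. *)
pose a : R := (t / 2 ^+ d) `^ q^-1.
have t2 : 0 < t / 2 ^+ d by rewrite divr_gt0// exprn_gt0.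
have a0 : 0 < a by rewrite powR_gt0.
apply: (@le_trans _ _ ((t `^ q^-1)%:E * (M / a)%:E)%E); last first.
  rewrite -EFinM lee_fin -[X in X `^ q^-1 * (M / a)](@divfK _ (2 ^+ d)) ?gt_eqF ?exprn_gt0//.
  rewrite powRM ?(ltW t2) ?exprn_ge0// -/a le_eqVlt; apply/orP; left; apply/eqP.
  by field; rewrite gt_eqF.
apply: lee_wpmul2l; first by rewrite lee_fin powR_ge0.
apply: rearrangement_le; first by rewrite divr_ge0// ltW.
pose r : R := t `^ d%:R^-1 / 2.
have r0 : 0 < r by rewrite divr_gt0// powR_gt0.
have rd : r ^+ d = t / 2 ^+ d by rewrite expr_div_n powR_invnK// ltW.
have ra : r `^ (- (d%:R / q)) = a^-1.
  by rewrite powRN powRrM powR_mulrn ?(ltW r0)// rd.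
have -> : t%:E = lebesgue_rV d (@box R d `](- r), r]%classic).
  rewrite lebesgue_rV_box_fin; last lra.
  have -> : r - - r = t `^ d%:R^-1 by rewrite opprK /r; field.
  by rewrite powR_invnK// ltW.
apply: le_measure; rewrite ?inE.
- rewrite [X in measurable X](_ : _ = setT `&` (fun x => `|eucl_norm x `^ (- (d%:R / q)) * u x|)
      @^-1` `](M / a), +oo[%classic); last first.
    by rewrite setTI; apply/seteqP; split=> y /=; rewrite in_itv/= andbT.
  have mf : measurable_fun setT (fun x => `|eucl_norm x `^ (- (d%:R / q)) * u x|).
    apply: measurableT_comp => //; apply: measurable_funM => //.
    apply: (measurableT_comp (measurable_powR _)).
    by apply: continuous_measurable_rV; exact: continuous_eucl_norm.
  exact: mf.
- exact: measurable_box.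
move=> x /= Mx i; rewrite /= in_itv/=.
have xr : eucl_norm x < r.
  rewrite ltNge; apply/negP => rx; move: Mx; apply/negP; rewrite -leNgt normrM.
  rewrite ger0_norm ?powR_ge0// mulrC ler_pM ?powR_ge0//.
  rewrite -ra !powRN lef_pV2 ?posrE ?powR_gt0 ?(lt_le_trans r0)//.
  by apply: ge0_ler_powR; rewrite ?nnegrE ?(ltW r0) ?eucl_norm_ge0 ?divr_ge0 ?(ltW q0).
have := le_lt_trans (coord_le_eucl_norm x i) xr.
by rewrite ltr_norml => /andP[-> /ltW ->].
Qed.

End weak_type.

(** * Smooth bump functions *)

Section flat_functions.
Context {R : realType}.
Implicit Types (P : {poly R}) (s y : R).

(** For [P = 1] this is the classical smooth function [exp(-1/s)] extended by 0; the polynomial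
    factor makes the family stable under differentiation. *)
Definition flat P s : R := if 0 < s then P.[s^-1] * expR (- s^-1) else 0.

(** The extra power [y^n] drives the induction on [P]: a factor ['X] is absorbed by passing to
    [n.+1], and constants use [y^n <= n! e^y]. *)
Lemma poly_expR_bounded P n : exists2 C : R, 0 < C &
  forall y, 0 <= y -> `|P.[y]| * y ^+ n * expR (- y) <= C.
Proof.
elim/poly_ind: P n => [|P c IH] n.
  by exists 1 => // y _; rewrite horner0 normr0 !mul0r.
have [C C0 hC] := IH n.+1.
exists (C + `|c| * (n.+1)`!%:R * 2 + `|c| * n`!%:R).
  by rewrite ltr_wpDr// ?mulr_ge0// ltr_wpDr// !mulr_ge0.
move=> y y0; rewrite hornerD hornerM hornerX hornerC.
have e0 := expR_gt0 (- y).
have yn0 : 0 <= y ^+ n by rewrite exprn_ge0.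
have h1 : `|P.[y] * y + c| * y ^+ n * expR (- y) <=
    `|P.[y]| * y ^+ n.+1 * expR (- y) + `|c| * (y ^+ n * expR (- y)).
  rewrite mulrA -mulrDl ler_wpM2r ?(ltW e0)// exprS mulrA -mulrDl ler_wpM2r//.
  by rewrite (le_trans (ler_normD _ _))// normrM (ger0_norm y0).
have h2 : y ^+ n * expR (- y) <= n`!%:R.
  rewrite expRN ler_pdivrMr ?expR_gt0//.
  case: n {IH hC yn0 h1} => [|n]; first by rewrite expr0 fact0 mul1r -expR0 ler_expR.
  have := expR_ge1Dxn n y0.
  have f0 : 0 < (n.+1)`!%:R :> R by rewrite ltr0n fact_gt0.
  move=> /(le_trans _) H; rewrite -ler_pdivrMl// mulrC; apply: H; lra.
have h3 := hC y y0.
have : `|c| * (y ^+ n * expR (- y)) <= `|c| * n`!%:R by rewrite ler_wpM2l.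
have : 0 <= `|c| * (n.+1)`!%:R * 2 by rewrite !mulr_ge0.
lra.
Qed.

Lemma flat_bounded P : exists2 C : R, 0 < C & forall s, `|flat P s| <= C * s ^+ 2.
Proof.
have [C C0 hC] := poly_expR_bounded P 2; exists C => // s; rewrite /flat.
case: ifPn => s0; last by rewrite normr0 mulr_ge0 ?sqr_ge0// ltW.
have := hC s^-1; rewrite invr_ge0 => /(_ (ltW s0)).
rewrite normrM (gtr0_norm (expR_gt0 _)) mulrAC exprVn ler_pdivrMr//.
by rewrite exprn_gt0.
Qed.

(** Away from 0 the product and chain rules give the factor [s^-2 (P - P')(s^-1)]. At 0 the
    quadratic bound of [flat_bounded] makes the difference quotients tend to 0. *)
Lemma is_derive_flat P s : is_derive s 1 (flat P) (flat ('X^2 * (P - P^`())) s).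
Proof.
case: (ltgtP s 0) => s0.
- rewrite [flat ('X^2 * _) s]/flat ltNge (ltW s0)/=.
  have E : \forall t \near s, cst 0 t = flat P t.
    near=> t; rewrite /flat ltNge ltW//; near: t; exact: lt_nbhsl.
  by apply: (near_eq_is_derive E); exact: is_derive_cst.
- rewrite [flat ('X^2 * _) s]/flat s0.
  have E : \forall t \near s, P.[t^-1] * expR (- t^-1) = flat P t.
    by near=> t; rewrite /flat ifT//; near: t; exact: lt_nbhsr.
  apply: (near_eq_is_derive E).
  have dV : is_derive s 1 (fun y : R => y^-1) (- s ^- 2).
    by rewrite -[- s ^- 2]mulr1; apply: (@is_deriveV _ id); rewrite gt_eqF.
  have dP := is_derive1_comp (is_derive_poly P s^-1) dV.
  have dO : is_derive s 1 (fun y : R => - y^-1) (s ^- 2).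
    by rewrite -[s ^- 2]opprK; exact: is_deriveN.
  have dN := @is_derive1_comp _ expR (fun y : R => - y^-1) s _ _ (is_derive_expR _) dO.
  apply: (is_derive_eq (is_deriveM dP dN)).
  rewrite /GRing.scale/= hornerM hornerXn hornerD hornerN exprVn.
  by ring.
- rewrite s0 [flat ('X^2 * _) 0]/flat ltxx.
  have [C C0 hC] := flat_bounded P.
  suff h : (fun h : R => h^-1 *: (flat P (h *: 1 + 0) - flat P 0)) @ 0^' --> 0.
    apply: DeriveDef; first by apply/cvg_ex; exists 0.
    exact: cvg_lim h.
  apply/cvgrPdist_le => e e0; near=> h.
  have h0 : h != 0 by near: h; exact: nbhs_dnbhs_neq.
  have he : `|h| < e / C by near: h; apply: dnbhs0_lt; rewrite divr_gt0.
  rewrite sub0r normrN /GRing.scale/= mulr1 addr0 [flat P 0]/flat ltxx subr0.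
  rewrite normrM normfV mulrC ler_pdivrMr ?normr_gt0//.
  rewrite (le_trans (hC h))// -real_normK ?num_real// expr2 mulrA ler_wpM2r//.
  by move: he; rewrite ltr_pdivlMr// mulrC => /ltW.
Unshelve. all: by end_near. Qed.

Lemma flat_le0 P s : s <= 0 -> flat P s = 0.
Proof. by rewrite /flat ltNge => ->. Qed.

Lemma flat1_itv s : 0 <= flat 1 s <= 1.
Proof.
rewrite /flat; case: ifPn => s0; last by rewrite lexx ler01.
by rewrite hornerC mul1r expR_ge0 -[leRHS]expR0 ler_expR oppr_le0 invr_ge0 ltW.
Qed.

Lemma flat1_ge s : 2^-1 <= s -> expR (- 2) <= flat 1 s.
Proof.
move=> s2; have s0 : 0 < s by rewrite (lt_le_trans _ s2).
by rewrite /flat s0 hornerC mul1r ler_expR lerN2 invf_ple ?posrE.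
Qed.

Lemma flat1_derive_le s : `|flat ('X^2 * (1 - 1^`())) s| <= 2.
Proof.
rewrite /flat; case: ifPn => s0; last by rewrite normr0.
rewrite -polyC1 derivC subr0 mulr1 hornerXn.
rewrite ger0_norm; last by rewrite mulr_ge0 ?expR_ge0 ?sqr_ge0.
have y0 : 0 <= s^-1 by rewrite invr_ge0 ltW.
rewrite expRN ler_pdivrMr ?expR_gt0//.
have := expR_ge1Dxn 1 y0; rewrite [(2)`!%:R](_ : _ = 2)//.
lra.
Qed.

End flat_functions.

Section flat_algebra.
Context {R : realType} {n : nat}.
Implicit Types (f : 'rV[R]_n -> R) (x : 'rV[R]_n).

(* The generators are stable under partial derivatives (up to multiplication by
   a constant), hence so is the algebra, and all its elements are smooth. *)
Inductive flat_algebra : ('rV[R]_n -> R) -> Prop :=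
| flat_algebra_cst c : flat_algebra (fun=> c)
| flat_algebra_gen P (a b : R) (j : 'I_n) :
    flat_algebra (fun x => flat P (a + b * x ord0 j))
| flat_algebra_add f g : flat_algebra f -> flat_algebra g ->
    flat_algebra (fun x => f x + g x)
| flat_algebra_mul f g : flat_algebra f -> flat_algebra g ->
    flat_algebra (fun x => f x * g x).

Lemma is_derive_coord (phi : R -> R) (dphi : R) x (i j : 'I_n) :
  is_derive (x ord0 j) 1 phi dphi ->
  is_derive x (delta_mx ord0 i : 'rV[R]_n) (fun x => phi (x ord0 j))
    (if i == j then dphi else 0).
Proof.
move=> dp; case: (eqVneq i j) => [->|ij].
  have E : (fun h : R => h^-1 *: (((fun x : 'rV[R]_n => phi (x ord0 j)) \o shift x)
        (h *: (delta_mx ord0 j : 'rV[R]_n)) - phi (x ord0 j))) =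
      (fun h : R => h^-1 *: ((phi \o shift (x ord0 j)) (h *: (1 : R)) - phi (x ord0 j))).
    by apply/funext => h; rewrite /= !mxE !eqxx.
  have [d <-] := dp; apply: DeriveDef; first by rewrite /derivable E; exact: d.
  by rewrite /derive E.
have E : (fun h : R => h^-1 *: (((fun x : 'rV[R]_n => phi (x ord0 j)) \o shift x)
      (h *: (delta_mx ord0 i : 'rV[R]_n)) - phi (x ord0 j))) = cst 0.
  apply/funext => h.
  by rewrite /= !mxE eqxx/= eq_sym (negbTE ij) mulr0 add0r subrr scaler0.
apply: DeriveDef; rewrite /derivable /derive E; first exact: is_cvg_cst.
exact: lim_cst.
Qed.

Lemma is_derive_flat_affine P (a b t : R) :
  is_derive t 1 (fun t => flat P (a + b * t)) (b * flat ('X^2 * (P - P^`())) (a + b * t)).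
Proof.
have dA : is_derive t 1 (fun t : R => a + b * t) b.
  apply: (is_derive_eq (is_deriveD (is_derive_cst a _ _) (is_deriveZ b (is_derive_id _ _)))).
  by rewrite add0r /GRing.scale/= mulr1.
rewrite mulrC.
exact: (@is_derive1_comp _ (flat P) (fun t => a + b * t) _ _ _ (is_derive_flat P _) dA).
Qed.

Lemma is_derive_flat_coord P (a b : R) x (i j : 'I_n) :
  is_derive x (delta_mx ord0 i : 'rV[R]_n) (fun x => flat P (a + b * x ord0 j))
    (if i == j then b * flat ('X^2 * (P - P^`())) (a + b * x ord0 j) else 0).
Proof.
apply: (@is_derive_coord (fun t => flat P (a + b * t))).
exact: is_derive_flat_affine.
Qed.

Lemma flat_algebra_derive f : flat_algebra f ->
  continuous f /\ forall i, exists2 g, flat_algebra g &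
    forall x, is_derive x (delta_mx ord0 i : 'rV[R]_n) f (g x).
Proof.
elim=> [c|P a b j|f1 f2 F1 [c1 d1] F2 [c2 d2]|f1 f2 F1 [c1 d1] F2 [c2 d2]].
- split; first by move=> x; exact: cst_continuous.
  move=> i; exists (fun=> 0); first exact: flat_algebra_cst.
  by move=> x; exact: is_derive_cst.
- split.
    move=> x; apply: (@continuous_comp _ _ _ (fun x : 'rV[R]_n => x ord0 j) (fun t => flat P (a + b * t))).
      exact: coord_continuous.
    apply: differentiable_continuous; apply/derivable1_diffP.
    have ft := is_derive_flat_affine P a b (x ord0 j).
    exact: (@ex_derive _ _ _ _ _ _ _ ft).
  move=> i; case: (eqVneq i j) => ij.
    exists (fun x => b * flat ('X^2 * (P - P^`())) (a + b * x ord0 j)).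
      exact: (flat_algebra_mul (flat_algebra_cst b) (flat_algebra_gen _ a b j)).
    by move=> x; apply: (is_derive_eq (is_derive_flat_coord P a b x i j)); rewrite ij eqxx.
  exists (fun=> 0); first exact: flat_algebra_cst.
  move=> x; apply: (is_derive_eq (is_derive_flat_coord P a b x i j)).
  by rewrite (negbTE ij).
- split; first by move=> x; exact: (cvgD (c1 x) (c2 x)).
  move=> i; have [g1 G1 h1] := d1 i; have [g2 G2 h2] := d2 i.
  exists (fun x => g1 x + g2 x); first exact: flat_algebra_add.
  by move=> x; exact: (is_deriveD (h1 x) (h2 x)).
- split; first by move=> x; exact: (cvgM (c1 x) (c2 x)).
  move=> i; have [g1 G1 h1] := d1 i; have [g2 G2 h2] := d2 i.
  exists (fun x => f1 x * g2 x + f2 x * g1 x).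
    by apply: flat_algebra_add; exact: flat_algebra_mul.
  by move=> x; exact: (is_deriveM (h1 x) (h2 x)).
Qed.

Lemma flat_algebra_smooth f : flat_algebra f -> smooth f.
Proof.
move=> Ff s.
have Fs : flat_algebra (partials s f).
  elim: s => //= i s /flat_algebra_derive[_ /(_ i)[g Fg dg]].
  rewrite (_ : partial i _ = g)//; apply/funext => x.
  by rewrite /partial; have dgx := dg x; rewrite derive_val.
have [cs ds] := flat_algebra_derive Fs; split=> // i x.
by have [g _ dg] := ds i; have dgx := dg x; exact: (@ex_derive _ _ _ _ _ _ _ dgx).
Qed.

Lemma flat_algebra_sum (I : Type) (r : seq I) (F : I -> 'rV[R]_n -> R) :
  (forall i, flat_algebra (F i)) -> flat_algebra (fun x => \sum_(i <- r) F i x).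
Proof.
move=> hF; elim: r => [|i r IH].
  rewrite (_ : (fun _ => _) = fun=> 0); first exact: flat_algebra_cst.
  by apply/funext => x; rewrite big_nil.
rewrite (_ : (fun _ => _) = fun x => F i x + \sum_(j <- r) F j x).
  exact: flat_algebra_add.
by apply/funext => x; rewrite big_cons.
Qed.

Lemma flat_algebra_prod (I : Type) (r : seq I) (F : I -> 'rV[R]_n -> R) :
  (forall i, flat_algebra (F i)) -> flat_algebra (fun x => \prod_(i <- r) F i x).
Proof.
move=> hF; elim: r => [|i r IH].
  rewrite (_ : (fun _ => _) = fun=> 1); first exact: flat_algebra_cst.
  by apply/funext => x; rewrite big_nil.
rewrite (_ : (fun _ => _) = fun x => F i x * \prod_(j <- r) F j x).
  exact: flat_algebra_mul.
by apply/funext => x; rewrite big_cons.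
Qed.

End flat_algebra.

(** * Sums of dyadic bumps *)

Section dyadic_bumps.
Context {R : realType} {n : nat}.
Implicit Types (f : 'rV[R]_n -> R) (x : 'rV[R]_n) (i : 'I_n).

Local Notation e_ i := (delta_mx ord0 i : 'rV[R]_n).

(** The boolean selects the sign: each coordinate contributes the factors [flat 1 (1 - 2^j x_i)] and
    [flat 1 (1 + 2^j x_i)], which cut off at [|x_i| = 2^-j]. *)
Definition dyadic_bump (j : nat) x : R :=
  \prod_(p : bool * 'I_n) flat 1 (1 + ((-1) ^+ p.1 * 2 ^+ j) * x ord0 p.2).

Definition dyadic_bumps (k : nat) x : R := \sum_(j < k) dyadic_bump j x.

Lemma flat_algebra_dyadic_bump j : flat_algebra (dyadic_bump j).
Proof.
have h (p : bool * 'I_n) : flat_algebra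
    (fun x : 'rV[R]_n => flat 1 (1 + ((-1) ^+ p.1 * 2 ^+ j) * x ord0 p.2)).
  exact: flat_algebra_gen.
exact: (flat_algebra_prod (index_enum (bool * 'I_n)%type) h).
Qed.

Lemma flat_algebra_dyadic_bumps k : flat_algebra (dyadic_bumps k).
Proof. by apply: flat_algebra_sum => j; exact: flat_algebra_dyadic_bump. Qed.

Lemma derive_prod_le (I : Type) (r : seq I) (F : I -> 'rV[R]_n -> R) i x (A : R) :
  (forall p x, `|F p x| <= 1) ->
  (forall p, exists2 L, is_derive x (e_ i) (F p) L & `|L| <= A) ->
  exists2 L, is_derive x (e_ i) (fun x => \prod_(p <- r) F p x) L & `|L| <= A *+ size r.
Proof.
move=> F1 dF.
have P1 s y : `|\prod_(p <- s) F p y| <= 1.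
  elim: s => [|p s IH]; first by rewrite big_nil normr1.
  by rewrite big_cons normrM -[leRHS]mul1r ler_pM.
elim: r => [|p r [L dL LA]].
  exists 0; last by rewrite normr0.
  rewrite (_ : (fun _ => _) = fun=> 1); last by apply/funext => y; rewrite big_nil.
  exact: is_derive_cst.
have [K dK KA] := dF p.
exists (F p x * L + (\prod_(p <- r) F p x) * K).
  rewrite (_ : (fun _ => _) = fun y => F p y * \prod_(p <- r) F p y); last first.
    by apply/funext => y; rewrite big_cons.
  exact: (is_deriveM dK dL).
rewrite /= mulrS addrC (le_trans (ler_normD _ _))// !normrM lerD//.
  by rewrite -[leRHS]mul1r ler_pM.
by rewrite -[leRHS]mul1r ler_pM.
Qed.

(** By the product rule, [2 n] factors bounded by 1 contribute at most [2 * 2^j] each. *)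
Lemma partial_dyadic_bump_le j i x :
  `|partial i (dyadic_bump j) x| <= (4 * n)%:R * 2 ^+ j.
Proof.
have [|p|L dL LA] := @derive_prod_le _ (index_enum (bool * 'I_n)%type)
    (fun p x => flat 1 (1 + ((-1) ^+ p.1 * 2 ^+ j) * x ord0 p.2)) i x (2 * 2 ^+ j).
- by move=> p y; have /andP[h0 h1] := flat1_itv (1 + ((-1) ^+ p.1 * 2 ^+ j) * y ord0 p.2); rewrite ger0_norm.
- eexists; first exact: is_derive_flat_coord.
  case: (i == p.2); last by rewrite normr0 mulr_ge0// exprn_ge0.
  rewrite normrM normrM normrX normrN1 expr1n mul1r mulrC ler_pM//.
    exact: flat1_derive_le.
  by rewrite ger0_norm// exprn_ge0.
have sz : size (index_enum (bool * 'I_n)%type) = (2 * n)%N.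
  by rewrite -sum1_size sum1_card card_prod card_bool card_ord.
rewrite /partial derive_val (le_trans LA)// sz -[leLHS]mulr_natr natrM [in leRHS]natrM.
by rewrite le_eqVlt; apply/orP; left; apply/eqP; ring.
Qed.

Lemma dyadic_bump_eq0 j i x : 1 <= 2 ^+ j * `|x ord0 i| -> dyadic_bump j x = 0.
Proof.
(* The index picks the factor whose sign is opposite to that of [x_i]; its argument is
   [1 - 2^j |x_i| <= 0]. *)
move=> xi; rewrite /dyadic_bump (bigD1 (0 <= x ord0 i, i))//= flat_le0 ?mul0r//.
move: xi; case: (leP 0 (x ord0 i)) => x0.
  by rewrite ger0_norm// expr1 mulN1r mulNr subr_le0.
by rewrite ltr0_norm// expr0 mul1r mulrN => ?; lra.
Qed.

Lemma partial_dyadic_bump_eq0 j i0 i x : 1 < 2 ^+ j * `|x ord0 i0| ->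
  partial i (dyadic_bump j) x = 0.
Proof.
move=> xi; rewrite /partial (@near_eq_derive _ _ _ _ (cst 0)); first exact: derive_cst.
have cx : {for x, continuous (fun y : 'rV[R]_n => 2 ^+ j * `|y ord0 i0|)}.
  apply: (@continuous_comp _ _ _ (fun y : 'rV[R]_n => y ord0 i0) (fun t => 2 ^+ j * `|t|)).
    exact: coord_continuous.
  by apply: cvgM; [exact: cvg_cst|exact: norm_continuous].
have : nbhs x [set y : 'rV[R]_n | 1 < 2 ^+ j * `|y ord0 i0|].
  exact: (cx _ (lt_nbhsr xi)).
by apply: filterS => y /ltW; exact: dyadic_bump_eq0.
Qed.

(** Gradient size over the scales that can still be felt once some coordinate exceeds [rho] in
    absolute value; finer bumps vanish there. *)
Definition dyadic_sum (k : nat) (rho : R) : R :=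
  \sum_(j < k) (if 2 ^+ j * rho <= 1 then 2 ^+ j else 0).

Lemma dyadic_sum_le k rho : dyadic_sum k rho <= 2 ^+ k.
Proof.
elim: k => [|k IH]; first by rewrite /dyadic_sum big_ord0.
rewrite /dyadic_sum big_ord_recr/= exprS mulrDl mul1r lerD//.
by case: ifP => // _; rewrite exprn_ge0.
Qed.

(** If the finest scale is active, the sum is at most [2^(k+1)] while [2^k rho <= 1]; otherwise that
    scale drops out and induction applies. *)
Lemma dyadic_sumM_le k rho : 0 <= rho -> dyadic_sum k rho * rho <= 2.
Proof.
move=> r0; elim: k => [|k IH]; first by rewrite /dyadic_sum big_ord0 mul0r.
case: (leP (2 ^+ k * rho) 1) => hk.
  rewrite (@le_trans _ _ (2 ^+ k.+1 * rho))//; first by rewrite ler_wpM2r// dyadic_sum_le.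
  by rewrite exprS -mulrA; lra.
by rewrite /dyadic_sum big_ord_recr/= (lt_geF hk) addr0.
Qed.

Lemma partial_dyadic_bumps_le k i i0 x rho : rho < `|x ord0 i0| ->
  `|partial i (dyadic_bumps k) x| <= (4 * n)%:R * dyadic_sum k rho.
Proof.
move=> xr.
have -> : partial i (dyadic_bumps k) x = \sum_(j < k) partial i (dyadic_bump j) x.
  have dj j : is_derive x (e_ i) (dyadic_bump j) (partial i (dyadic_bump j) x).
    by apply: DeriveDef => //; have [_] := flat_algebra_smooth (flat_algebra_dyadic_bump j) [::]; exact.
  have ds := @is_derive_sum _ _ _ k (fun j : 'I_k => dyadic_bump j) x (e_ i) _ (fun j => dj j).
  rewrite [LHS]/partial (_ : dyadic_bumps k = \sum_(j < k) dyadic_bump j); first by rewrite derive_val.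
  by apply/funext => y; rewrite fct_sumE.
rewrite (le_trans (ler_norm_sum _ _ _))// /dyadic_sum mulr_sumr ler_sum// => j _.
case: ifPn => hj; first exact: partial_dyadic_bump_le.
rewrite mulr0 (@partial_dyadic_bump_eq0 _ i0) ?normr0//.
rewrite -ltNge in hj; rewrite (lt_le_trans hj)// ler_wpM2l ?exprn_ge0//.
exact: ltW.
Qed.

Lemma eucl_norm_le x (a : R) : (forall i, `|x ord0 i| <= a) -> eucl_norm x <= n%:R * a.
Proof.
move=> xa; rewrite /eucl_norm.
have na : 0 <= n%:R * a.
  case: n x xa => [|m] x xa; first by rewrite mul0r.
  by rewrite mulr_ge0// (le_trans _ (xa ord0)).
rewrite -[leRHS]ger0_norm// -sqrtr_sqr ler_wsqrtr//.
rewrite (@le_trans _ _ (\sum_(i < n) a ^+ 2))//.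
  by apply: ler_sum => i _; rewrite -[leLHS]real_normK ?num_real// lerXn2r ?nnegrE ?(le_trans _ (xa i)).
rewrite sumr_const card_ord -[leLHS]mulr_natl exprMn ler_wpM2r ?sqr_ge0//.
by rewrite -natrX ler_nat; case: n => // m; rewrite expnS leq_pmulr.
Qed.

Lemma grad_dyadic_bumps_le k i0 x rho : rho < `|x ord0 i0| ->
  eucl_norm (grad (dyadic_bumps k) x) <= (n * (4 * n))%:R * dyadic_sum k rho.
Proof.
move=> xr; rewrite natrM -mulrA; apply: eucl_norm_le => i; rewrite mxE.
exact: partial_dyadic_bumps_le xr.
Qed.

Lemma grad_dyadic_bumps_eq0 k i0 x : 1 < `|x ord0 i0| ->
  eucl_norm (grad (dyadic_bumps k) x) = 0.
Proof.
move=> xr; apply/le_anti; rewrite eucl_norm_ge0 andbT.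
(* A threshold strictly above 1 leaves no active scale in [dyadic_sum]. *)
have [y /andP[y1 yx]] : exists y : R, (1 < y) && (y < `|x ord0 i0|).
  by exists ((1 + `|x ord0 i0|) / 2); apply/andP; split; lra.
rewrite (le_trans (grad_dyadic_bumps_le k yx))// /dyadic_sum big1 ?mulr0// => j _.
rewrite ifF//; apply/negbTE; rewrite -ltNge.
by rewrite (lt_le_trans y1)// ler_peMl ?exprn_ege1 ?ler1n// ltW// (lt_trans _ y1).
Qed.

Lemma dyadic_bumps_eq0 k i0 x : 1 <= `|x ord0 i0| -> dyadic_bumps k x = 0.
Proof.
move=> xi; rewrite /dyadic_bumps big1// => j _; apply: (@dyadic_bump_eq0 _ i0).
by rewrite (le_trans xi)// ler_peMl// exprn_ege1// ler1n.
Qed.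

Lemma test_function_dyadic_bumps k : test_function (dyadic_bumps k).
Proof.
split; first exact/flat_algebra_smooth/flat_algebra_dyadic_bumps.
apply: bounded_closed_compact; last exact: closed_closure.
exists 1; split; first exact: num_real.
move=> M M1 x xS; apply: le_trans (ltW M1).
have cl : closed [set y : 'rV[R]_n | `|y| <= 1].
  apply: (@closed_comp _ _ (fun y : 'rV[R]_n => `|y|) [set t | t <= 1]).
    by move=> y _; exact: norm_continuous.
  exact: closed_le.
suff sub : [set x | dyadic_bumps k x != 0] `<=` [set y : 'rV[R]_n | `|y| <= 1].
  by move: (closureS sub xS); rewrite -(closure_id _).1.
move=> y /= uy; rewrite -[leLHS]/(mx_norm y) mx_normrE.
apply: bigmax_le => // -[a i] _ /=; rewrite (ord1 a).
rewrite leNgt; apply: contra uy => yi; apply/eqP.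
by apply: (@dyadic_bumps_eq0 _ i); exact: ltW.
Qed.

(** For [j < k] one has [2^j x_i <= 1/2], so every argument [1 - 2^j x_i] or [1 + 2^j x_i] is at
    least [1/2], and each of the [2 n] factors is at least [exp(-2)]. *)
Lemma dyadic_bumps_ge k x : (forall i, 0 < x ord0 i <= 2 ^- k) ->
  k%:R * expR (- 2) ^+ (2 * n) <= dyadic_bumps k x.
Proof.
move=> xk; rewrite mulr_natl /dyadic_bumps -[X in _ *+ X]card_ord -sumr_const.
apply: ler_sum => j _; rewrite /dyadic_bump.
rewrite (_ : (2 * n)%N = #|{: bool * 'I_n}|); last by rewrite card_prod card_bool card_ord.
rewrite -prodr_const; apply: ler_prod => -[b i] _; rewrite expR_ge0/=; apply: flat1_ge.
have /andP[x0 xi] := xk i.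
have h : 2 ^+ j * x ord0 i <= 2^-1.
  rewrite (le_trans (ler_wpM2l _ xi)) ?exprn_ge0//.
  by rewrite ler_pdivrMr ?exprn_gt0// ler_pdivlMl// -exprS ler_eXn2l// ltr1n.
have h0 : 0 <= 2 ^+ j * x ord0 i by rewrite mulr_ge0 ?exprn_ge0 ?ltW.
by case: b; rewrite ?expr1 ?expr0 ?mulN1r ?mul1r ?mulNr; lra.
Qed.

End dyadic_bumps.

(** * One-dimensional integrals of powers and of the inverse *)

Section power_log_integrals.
Context {R : realType}.
Local Notation leb := (@lebesgue_measure R).

Lemma integral_powR_near0 (p a : R) : 0 < p -> 0 < a ->
  (\int[leb]_(t in `]0%R, a]) (t `^ (p - 1))%:E <= (a `^ p / p)%:E)%E.
Proof.
move=> p0 a0.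
(* The integrand may blow up at 0, so the interval is exhausted by compact ones and the bound passes
   to the limit; [i.+2] keeps each of them nondegenerate. *)
pose F i : set R := `[a / i.+2%:R, a]%classic.
have mf (D : set R) : measurable_fun D (fun t : R => (t `^ (p - 1))%:E).
  by apply/measurable_EFinP; apply: (measurable_funS _ (subsetT _)) => //; exact: measurable_powR.
have FE : `]0%R, a]%classic = \bigcup_i F i.
  apply/seteqP; split=> t /=.
    rewrite in_itv/= => /andP[t0 ta]; exists (Num.bound (a / t)) => //.
    rewrite /F /= in_itv/= ta andbT ler_pdivrMr// -ler_pdivrMl//.
    rewrite mulrC (le_trans (ltW (archi_boundP _)))//; last by rewrite ler_nat ltnW.
    by rewrite divr_ge0// ltW.
  move=> [i _]; rewrite /F /= !in_itv/= => /andP[it ->]; rewrite andbT.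
  by rewrite (lt_le_trans _ it)// divr_gt0.
have ndF : {homo F : i j / (i <= j)%N >-> (i <= j)%O}.
  move=> i j ij; apply/subsetPset => t; rewrite /F /= !in_itv/= => /andP[it ->].
  by rewrite andbT (le_trans _ it)// ler_pM2l// lef_pV2 ?posrE// ler_nat.
have cvgF : (\int[leb]_(t in F i) (t `^ (p - 1))%:E @[i --> \oo] -->
    \int[leb]_(t in \bigcup_i F i) (t `^ (p - 1))%:E)%E.
  apply: (@ge0_nondecreasing_set_cvg_integral _ (measurableTypeR R) R F _ leb) => //.
  - by move=> i; exact: measurable_itv.
  - by move=> i; exact: mf.
  - by move=> i t _; rewrite lee_fin powR_ge0.
rewrite FE.
rewrite -(cvg_lim _ cvgF)//; apply: lime_le; first by apply/cvg_ex; eexists; exact: cvgF.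
apply: nearW => i; rewrite /F.
have e0 : 0 < a / i.+2%:R by rewrite divr_gt0.
have ea : a / i.+2%:R < a by rewrite ltr_pdivrMr// ltr_pMr// ltr1n.
have dG (t : R) : 0 < t -> is_derive t 1 (fun t : R => t `^ p / p) (t `^ (p - 1)).
  move=> t0; have dt := is_derive1_powR p t0.
  have := is_deriveZ p^-1 dt; rewrite (_ : _ \*: _ = fun t : R => t `^ p / p); last first.
    by apply/funext => y; rewrite /GRing.scale/= mulrC.
  by move=> dZ; apply: (is_derive_eq dZ); rewrite /GRing.scale/= mulrA mulVf ?mul1r ?gt_eqF.
have cG (t : R) : 0 < t -> {for t, continuous (fun t : R => t `^ p / p)}.
  move=> t0; apply: differentiable_continuous; apply/derivable1_diffP.
  by have dt := dG t t0; exact: (@ex_derive _ _ _ _ _ _ _ dt).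
have cg (t : R) : 0 < t -> {for t, continuous (fun t : R => t `^ (p - 1))}.
  move=> t0; apply: differentiable_continuous; apply/derivable1_diffP.
  by have dt := is_derive1_powR (p - 1) t0; exact: (@ex_derive _ _ _ _ _ _ _ dt).
rewrite (@continuous_FTC2 _ _ (fun t : R => t `^ p / p))//.
- by rewrite -EFinD lee_fin lerBlDr lerDl divr_ge0 ?powR_ge0 ?(ltW p0).
- apply: continuous_in_subspaceT => t; rewrite inE/= in_itv/= => /andP[et _].
  by apply: cg; rewrite (lt_le_trans e0).
- split.
  + move=> t; rewrite in_itv/= => /andP[et _].
    by have dt := dG t (lt_trans e0 et); exact: (@ex_derive _ _ _ _ _ _ _ dt).
  + exact/cvg_at_right_filter/cG.
  + exact/cvg_at_left_filter/cG.
- move=> t; rewrite in_itv/= => /andP[et _].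
  by rewrite derive1E; have dt := dG t (lt_trans e0 et); rewrite derive_val.
Qed.

Lemma integral_inv (a b : R) : 0 < a -> a < b ->
  (\int[leb]_(t in `]a, b]) (t^-1)%:E = (ln b - ln a)%:E)%E.
Proof.
move=> a0 ab.
have gt0 (t : R) : a <= t -> 0 < t by exact: lt_le_trans.
have cl (t : R) : 0 < t -> {for t, continuous (@ln R)}.
  move=> t0; apply: differentiable_continuous; apply/derivable1_diffP.
  by have dt := is_derive1_ln t0; exact: (@ex_derive _ _ _ _ _ _ _ dt).
rewrite integral_itv_obnd_cbnd; last first.
  apply/measurable_EFinP; apply: (measurable_funS _ (subsetT _)) => //.
  by have := @measurable_invX R 1; under eq_fun do rewrite expr1.
rewrite (@continuous_FTC2 _ _ (@ln R))//.
- apply: continuous_in_subspaceT => t; rewrite inE/= in_itv/= => /andP[et _].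
  by apply: inv_continuous; rewrite gt_eqF// gt0.
- split.
  + move=> t; rewrite in_itv/= => /andP[/ltW/gt0 t0 _].
    by have dt := is_derive1_ln t0; exact: (@ex_derive _ _ _ _ _ _ _ dt).
  + exact/cvg_at_right_filter/cl.
  + exact/cvg_at_left_filter/cl/gt0/ltW.
- move=> t; rewrite in_itv/= => /andP[/ltW/gt0 t0 _].
  by rewrite derive1E; have dt := is_derive1_ln t0; rewrite derive_val.
Qed.

End power_log_integrals.

(** * Upper bounds for the gradient norms of the dyadic sums *)

Section dyadic_rearrangement.
Context {R : realType} {n : nat}.
Local Notation d := (n.+2).
Local Notation leb := (@lebesgue_measure R).
Local Notation K := ((d * (4 * d))%:R : R).
Let g k (x : 'rV[R]_d) : R := eucl_norm (grad (dyadic_bumps k) x).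

Lemma lebesgue_rV_cube (m : nat) (rho : R) : 0 < rho ->
  lebesgue_rV m (@box R m `[(- rho), rho]%classic) = ((2 * rho) ^+ m)%:E.
Proof.
move=> r0; rewrite lebesgue_rV_box// lebesgue_measure_itv/= lte_fin.
by rewrite ifT; [rewrite -EFinD -EFin_expe opprK mulr_natl mulr2n|lra].
Qed.

Lemma measurable_dyadic_grad k : measurable_fun setT (g k).
Proof.
apply: continuous_measurable_rV; apply: continuous_eucl_norm_grad => i.
by have [] := flat_algebra_smooth (@flat_algebra_dyadic_bumps R d k) [:: i].
Qed.

Lemma rearrangement_le_cube k (rho s t : R) : 0 < rho -> 0 <= s -> (2 * rho) ^+ d <= t ->
  (forall (x : 'rV[R]_d) i, rho < `|x ord0 i| -> g k x <= s) ->
  (rearrangement (lebesgue_rV d) (g k) t <= s%:E)%E.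
Proof.
move=> r0 s0 rt gs; apply: rearrangement_le => //.
rewrite (@le_trans _ _ ((2 * rho) ^+ d)%:E)// -lebesgue_rV_cube//.
apply: le_measure; rewrite ?inE; [|exact: measurable_box|].
  rewrite [X in measurable X](_ : _ = setT `&` (g k) @^-1` `]s, +oo[%classic).
    exact: measurable_dyadic_grad.
  by rewrite setTI; apply/seteqP; split=> y /=; rewrite in_itv/= andbT ger0_norm ?eucl_norm_ge0.
move=> x /=; rewrite ger0_norm ?eucl_norm_ge0// => sx i; rewrite /= in_itv/= -ler_norml.
by rewrite leNgt; apply/negP => /gs; rewrite leNgt sx.
Qed.

Lemma rearrangement_dyadic_le1 k (t : R) : 0 <= t ->
  (rearrangement (lebesgue_rV d) (g k) t <= (K * 2 ^+ k)%:E)%E.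
Proof.
move=> t0; apply: rearrangement_le; first by rewrite mulr_ge0// exprn_ge0.
rewrite (_ : [set _ | _] = set0) ?measure0//; apply/seteqP; split=> // x /=.
rewrite ger0_norm ?eucl_norm_ge0//; apply/negP; rewrite -leNgt.
(* Any threshold below [|x_0|] would do, since [dyadic_sum_le] is uniform in it. *)
have x1 : `|x ord0 ord0| - 1 < `|x ord0 ord0| by rewrite ltrBlDr ltrDl.
by rewrite (le_trans (grad_dyadic_bumps_le k x1))// ler_wpM2l// dyadic_sum_le.
Qed.

(** The cube of half-side [rho = t^(1/d) / 2] has volume [t], and off it the gradient is at most
    [2 K / rho]. *)
Lemma rearrangement_dyadic_le2 k (t : R) : 0 < t ->
  (rearrangement (lebesgue_rV d) (g k) t <= (4 * K / t `^ d%:R^-1)%:E)%E.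
Proof.
move=> t0; have a0 : 0 < t `^ d%:R^-1 by rewrite powR_gt0.
have r0 : 0 < t `^ d%:R^-1 / 2 by rewrite divr_gt0.
apply: (rearrangement_le_cube r0).
- by rewrite divr_ge0 ?mulr_ge0// ltW.
- by rewrite mulrC divfK// powR_invnK// ltW.
- move=> x i xi; rewrite (le_trans (grad_dyadic_bumps_le k xi))//.
  rewrite ler_pdivlMr// [4 * K]mulrC -mulrA ler_wpM2l//.
  have := dyadic_sumM_le k (ltW r0).
  lra.
Qed.

Lemma rearrangement_dyadic_le0 k (t : R) : 2 ^+ d <= t ->
  (rearrangement (lebesgue_rV d) (g k) t <= 0)%E.
Proof.
move=> t2; apply: (@rearrangement_le_cube k 1) => //; first by rewrite mulr1.
by move=> x i xi; rewrite /g (grad_dyadic_bumps_eq0 k xi).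
Qed.

Lemma lorentz_dyadic_le_oo k :
  (lorentz_norm (lebesgue_rV d) d%:R +oo (g k) <= (4 * K)%:E)%E.
Proof.
apply: ge_ereal_sup => _ /= [t + <-]; rewrite in_itv/= andbT => t0.
have a0 : 0 < t `^ d%:R^-1 by rewrite powR_gt0.
apply: (@le_trans _ _ ((t `^ d%:R^-1)%:E * (4 * K / t `^ d%:R^-1)%:E)%E).
  by apply: lee_wpmul2l; [rewrite lee_fin ltW|exact: rearrangement_dyadic_le2].
by rewrite -EFinM lee_fin mulrC divfK// gt_eqF.
Qed.

Lemma lorentz_dyadic_le (r : R) : 1 < r -> exists2 A : R, 0 <= A & forall k,
  (lorentz_norm (lebesgue_rV d) d%:R r%:E (g k) <= ((A * k.+1%:R) `^ r^-1)%:E)%E.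
Proof.
move=> r1; have r0 : 0 < r by lra.
pose p := r / d%:R; have p0 : 0 < p by rewrite divr_gt0.
have l20 : 0 <= ln 2 :> R by rewrite ln_ge0// ler1n.
pose c2 := (4 * K) `^ r.
have c20 : 0 <= c2 by exact: powR_ge0.
exists (K `^ r + p * (c2 * (d%:R * ln 2))).
  by rewrite addr_ge0 ?powR_ge0// !mulr_ge0// ltW.
move=> k.
(* Below [a = 2^(-k d)] the bound [K 2^k] is used and contributes a constant, as [2^k a^(1/d) = 1].
   Between [a] and [b], the total volume of the support cube, the bound [4 K t^(-1/d)] leaves
   [dt / t], of mass [ln b - ln a = d (k+1) ln 2]. Beyond [b] nothing remains. *)
pose a : R := (2 ^- k) ^+ d; have a0 : 0 < a by rewrite exprn_gt0// invr_gt0 exprn_gt0.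
pose b : R := 2 ^+ d.
have ab : a < b.
  rewrite (@le_lt_trans _ _ 1)// ?exprn_egt1 ?ltr1n// exprn_ile1 ?invr_ge0 ?exprn_ge0//.
  by rewrite invf_le1 ?exprn_gt0// exprn_ege1// ler1n.
have mV D : measurable_fun D (fun t : R => t^-1).
  apply: (measurable_funS _ (subsetT _)) => //.
  by have := @measurable_invX R 1; under eq_fun do rewrite expr1.
have mP D (e : R) : measurable_fun D (fun t : R => t `^ e).
  by apply: (measurable_funS _ (subsetT _)) => //; exact: measurable_powR.
pose c1 := (K * 2 ^+ k) `^ r.
have c10 : 0 <= c1 by exact: powR_ge0.
pose I (t : R) : \bar R :=
  ((((t `^ d%:R^-1)%:E * rearrangement (lebesgue_rV d) (g k) t) `^ r) * (t^-1)%:E)%E.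
pose h1 : R -> \bar R := (fun t : R => (c1 * t `^ (p - 1))%:E) \_ `]0, a]%classic.
pose h2 : R -> \bar R := (fun t : R => (c2 * t^-1)%:E) \_ `]a, b]%classic.
have mI D : measurable_fun D I.
  apply: emeasurable_funM; last exact/measurable_EFinP.
  apply: (measurableT_comp (measurable_poweR r)); apply: emeasurable_funM.
    exact/measurable_EFinP.
  exact: measurable_rearrangement.
have Ile t s : 0 < t -> 0 <= s -> (rearrangement (lebesgue_rV d) (g k) t <= s%:E)%E ->
    (I t <= ((t `^ d%:R^-1 * s) `^ r * t^-1)%:E)%E.
  move=> t0 s0 ts; rewrite EFinM; apply: lee_wpmul2r; first by rewrite lee_fin invr_ge0 ltW.
  rewrite -(poweR_EFin (t `^ d%:R^-1 * s)); apply: gt0_ler_poweR; first exact: ltW.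
  - by rewrite in_itv/= leey andbT mule_ge0 ?lee_fin ?powR_ge0 ?rearrangement_ge0.
  - by rewrite in_itv/= leey andbT lee_fin mulr_ge0 ?powR_ge0.
  - by rewrite EFinM; apply: lee_wpmul2l => //; rewrite lee_fin powR_ge0.
have I0 t : 0 < t -> (0 <= I t)%E.
  by move=> t0; rewrite mule_ge0 ?poweR_ge0// lee_fin invr_ge0 ltW.
have h10 t : (0 <= h1 t)%E.
  by rewrite /h1 patchE; case: ifPn => // _; rewrite lee_fin mulr_ge0// powR_ge0.
have h20 t : (0 <= h2 t)%E.
  rewrite /h2 patchE; case: ifPn => //; rewrite inE/= in_itv/= => /andP[ta _].
  by rewrite lee_fin mulr_ge0// invr_ge0 ltW// (lt_trans a0).
have mh1 : measurable_fun setT h1.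
  apply/(measurable_restrictT _ _).1 => //; apply/measurable_EFinP.
  exact: measurable_funM.
have mh2 : measurable_fun setT h2.
  apply/(measurable_restrictT _ _).1 => //; apply/measurable_EFinP.
  exact: measurable_funM.
have IT : (\int[leb]_(t in `]0%R, +oo[) I t <= (c1 * (a `^ p / p) + c2 * (ln b - ln a))%:E)%E.
  apply: (@le_trans _ _ (\int[leb]_t (h1 t + h2 t))%E).
    rewrite integral_mkcond; apply: ge0_le_integral => //.
    - by move=> t _; rewrite patchE; case: ifPn => //; rewrite inE/= in_itv/= andbT; exact: I0.
    - by apply/(measurable_restrictT _ _).1 => //; exact: mI.
    - exact: emeasurable_funD.
    - move=> t _; rewrite patchE; case: ifPn => [|_]; last by rewrite adde_ge0.
      rewrite inE/= in_itv/= andbT => t0.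
      have K2 : 0 <= K * 2 ^+ k by rewrite mulr_ge0// exprn_ge0.
      case: (leP t a) => ta.
        rewrite (le_trans _ (leeDl _ (h20 t)))// /h1 patchE mem_set/= ?in_itv/= ?t0//.
        rewrite (le_trans (Ile t _ t0 K2 (rearrangement_dyadic_le1 k (ltW t0))))//.
        rewrite lee_fin powRM ?powR_ge0// -powRrM mulrC mulrA (mulrC _ c1).
        rewrite ler_wpM2l// [d%:R^-1 * r]mulrC -/p mulrC powRD ?powR_inv1 ?(ltW t0)//.
        by rewrite [t == 0]gt_eqF// implybT.
      rewrite (le_trans _ (leeDr _ (h10 t)))// /h2 patchE.
      case: (leP t b) => tb.
        rewrite mem_set/= ?in_itv/= ?ta//.
        have tK : 0 <= 4 * K / t `^ d%:R^-1 by rewrite divr_ge0 ?mulr_ge0 ?powR_ge0.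
        rewrite (le_trans (Ile t _ t0 tK (rearrangement_dyadic_le2 k t0)))//.
        by rewrite lee_fin [_ * (4 * K / _)]mulrC divfK// gt_eqF// powR_gt0.
      rewrite memNset/= ?in_itv/=; last by apply/negP; rewrite ta/= -ltNge.
      rewrite (le_trans (Ile t 0 t0 (lexx _) (rearrangement_dyadic_le0 k (ltW tb))))//.
      by rewrite mulr0 powR0 ?mul0r// gt_eqF.
  rewrite ge0_integralD// EFinD leeD//.
    rewrite /h1 -integral_mkcond; under eq_integral do rewrite EFinM.
    rewrite ge0_integralZl_EFin//.
    - by rewrite EFinM; apply: lee_wpmul2l => //; exact: integral_powR_near0.
    - by move=> t _; rewrite lee_fin powR_ge0.
    - by apply/measurable_EFinP; exact: mP.
  rewrite /h2 -integral_mkcond; under eq_integral do rewrite EFinM.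
  rewrite ge0_integralZl_EFin//.
  - by rewrite integral_inv// -EFinM.
  - move=> t /=; rewrite in_itv/= => /andP[ta _].
    by rewrite lee_fin invr_ge0 ltW// (lt_trans a0).
  - by apply/measurable_EFinP; exact: mV.
have total : p * (c1 * (a `^ p / p) + c2 * (ln b - ln a)) <=
   (K `^ r + p * (c2 * (d%:R * ln 2))) * k.+1%:R.
  have -> : p * (c1 * (a `^ p / p) + c2 * (ln b - ln a)) =
      c1 * a `^ p + p * (c2 * (ln b - ln a)) by field; rewrite gt_eqF.
  have -> : c1 * a `^ p = K `^ r.
    have -> : a `^ p = (2 ^- k) `^ r.
      rewrite /a -powR_mulrn ?invr_ge0 ?exprn_ge0// -powRrM; congr (_ `^ _).
      by rewrite /p mulrC divfK ?pnatr_eq0.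
    by rewrite -powRM ?mulr_ge0 ?invr_ge0 ?exprn_ge0// mulfK ?gt_eqF// exprn_gt0.
  have -> : ln b - ln a = d%:R * ln 2 * k.+1%:R.
    rewrite /a /b !lnXn ?invr_gt0 ?exprn_gt0// lnV ?posrE ?exprn_gt0// lnXn//.
    have E (x : R) m : x *+ m = m%:R * x by rewrite mulr_natl.
    by rewrite -natr1 (E (ln 2) d) (E (- _) d) (E (ln 2) k); ring.
  rewrite [leRHS]mulrDl lerD//; last by rewrite !mulrA.
  by rewrite ler_peMr ?powR_ge0// ler1n.
rewrite /lorentz_norm -/p -poweR_EFin.
apply: gt0_ler_poweR; first by rewrite invr_ge0 ltW.
- rewrite in_itv/= leey andbT mule_ge0 ?lee_fin ?(ltW p0)//.
  by apply: integral_ge0 => t; rewrite /= in_itv/= andbT; exact: I0.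
- rewrite in_itv/= leey andbT lee_fin mulr_ge0// addr_ge0 ?powR_ge0//.
  by rewrite !mulr_ge0// ltW.
rewrite -/I (le_trans (lee_wpmul2l _ IT))// ?lee_fin ?(ltW p0)//.
Qed.

End dyadic_rearrangement.

(** * Lower bound for the weighted weak norm *)

Section dyadic_lower_bound.
Context {R : realType} {n : nat}.
Local Notation d := (n.+2).

Lemma lorentz_dyadic_ge (q : R) : 0 < q -> exists2 c : R, 0 < c & forall k,
  ((c * k%:R)%:E <= lorentz_norm (lebesgue_rV d) q +oo
    (fun x => eucl_norm x `^ (- (d%:R / q)) * dyadic_bumps k x)%R)%E.
Proof.
move=> q0; pose c0 : R := expR (- 2) ^+ (2 * d).
have c00 : 0 < c0 by rewrite exprn_gt0// expR_gt0.
exists (2^-1 `^ q^-1 * (d%:R `^ (- (d%:R / q)) * c0)).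
  apply: mulr_gt0; first by apply: powR_gt0; rewrite invr_gt0.
  by apply: mulr_gt0 => //; apply: powR_gt0; rewrite ltr0n.
move=> k; pose h : R := 2 ^- k; have h0 : 0 < h by rewrite invr_gt0 exprn_gt0.
(* Half the volume of the cube of side [h]: a superlevel set containing the cube is then too large
   to be admissible at [t], which forces the rearrangement there up to [L]. *)
pose t := h ^+ d / 2; have t0 : 0 < t by rewrite divr_gt0// exprn_gt0.
pose L := (d%:R * h) `^ (- (d%:R / q)) * (k%:R * c0).
have cL : 2^-1 `^ q^-1 * (d%:R `^ (- (d%:R / q)) * c0) * k%:R = t `^ q^-1 * L.
  rewrite /t /L powRM ?exprn_ge0 ?invr_ge0 ?(ltW h0)// powRM ?(ltW h0)//.
  rewrite -(powR_mulrn _ (ltW h0)) -powRrM.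
  (* The powers of [h] from the volume and from the weight cancel, so only the number [k] of bumps
     remains. *)
  have e : h `^ (d%:R / q) * h `^ (- (d%:R / q)) = 1.
    by rewrite powRN mulfV// gt_eqF// powR_gt0.
  move: (h `^ (d%:R / q)) (h `^ (- (d%:R / q))) e (d%:R `^ _) (2^-1 `^ _) (k%:R) => X Y e Z W V.
  by rewrite -[LHS]mulr1 -e; ring.
rewrite cL EFinM.
apply: (@le_trans _ _ ((t `^ q^-1)%:E * rearrangement (lebesgue_rV d)
    (fun x => eucl_norm x `^ (- (d%:R / q)) * dyadic_bumps k x)%R t)%E); last first.
  by apply: ereal_sup_ubound; exists t => //=; rewrite in_itv/= andbT.
apply: lee_wpmul2l; first by rewrite lee_fin powR_ge0.
apply: le_rearrangement => s s0 st; rewrite lee_fin leNgt; apply/negP => sL.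
have : ((h ^+ d)%:E <= t%:E)%E.
  apply: le_trans st; rewrite -[h]subr0 -(lebesgue_rV_box_fin d (ltW h0)).
  apply: le_measure; rewrite ?inE; [exact: measurable_box| |].
    rewrite [X in measurable X](_ : _ = setT `&`
      (fun x => `|eucl_norm x `^ (- (d%:R / q)) * dyadic_bumps k x|) @^-1` `]s, +oo[%classic); last first.
      by rewrite setTI; apply/seteqP; split=> y /=; rewrite in_itv/= andbT.
    have mf : measurable_fun setT (fun x : 'rV[R]_d =>
        `|eucl_norm x `^ (- (d%:R / q)) * dyadic_bumps k x|).
      apply: measurableT_comp => //; apply: measurable_funM.
        apply: (measurableT_comp (measurable_powR _)).
        by apply: continuous_measurable_rV; exact: continuous_eucl_norm.
      apply: continuous_measurable_rV.
      by have [] := flat_algebra_derive (@flat_algebra_dyadic_bumps R d k).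
    exact: mf.
  move=> x xh; rewrite /= (lt_le_trans sL)// (le_trans _ (ler_norm _))//.
  have xh' i : 0 < x ord0 i <= h by have := xh i; rewrite /= in_itv.
  (* The half-open cube omits the origin, so the weight can be compared through its negative
     exponent. *)
  have x0 : 0 < eucl_norm x.
    have /andP[x0 _] := xh' ord0; rewrite (lt_le_trans x0)//.
    exact: le_trans (ler_norm _) (coord_le_eucl_norm x ord0).
  have xd : eucl_norm x <= d%:R * h.
    by apply: eucl_norm_le => i; have /andP[x1 x2] := xh' i; rewrite gtr0_norm.
  have kc0 : 0 <= k%:R * c0 by apply: mulr_ge0 => //; exact: ltW.
  apply: ler_pM; [exact: powR_ge0|exact: kc0| |exact: dyadic_bumps_ge].
  rewrite !powRN lef_pV2 ?posrE ?powR_gt0 ?mulr_gt0//.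
  apply: ge0_ler_powR; rewrite ?nnegrE ?(ltW x0) ?divr_ge0 ?(ltW q0) ?mulr_ge0 ?(ltW h0)//.
rewrite lee_fin /t leNgt => /negP; apply.
by rewrite ltr_pdivrMr// ltr_pMr ?exprn_gt0// ltr1n.
Qed.

End dyadic_lower_bound.

Section growth.
Context {R : realType}.

(** Raised to the power [r], the inequality at [m >= 1] gives [c^r m^r <= C^r A (m+1) <= 2 C^r A m],
    hence [m^(r-1) <= D], which fails for large [m] as [r > 1]. *)
Lemma powR_linear_growth (r c C A : R) : 1 < r -> 0 < c -> 0 < C -> 0 <= A ->
  ~ forall k : nat, c * k%:R <= C * (A * k.+1%:R) `^ r^-1.
Proof.
move=> r1 c0 C0 A0 H; have r0 : 0 < r by lra.
pose D := C `^ r * (A * 2) / c `^ r.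
have D0 : 0 <= D by rewrite divr_ge0 ?powR_ge0// mulr_ge0 ?powR_ge0// mulr_ge0.
have r10 : 0 < r - 1 by lra.
pose m := Num.bound (D `^ (r - 1)^-1).
have Dm : D `^ (r - 1)^-1 < m%:R by rewrite archi_boundP// powR_ge0.
have m0 : 0 < m%:R :> R by rewrite (le_lt_trans _ Dm)// powR_ge0.
have mD : m%:R `^ (r - 1) <= D.
  have h : (c * m%:R) `^ r <= (C * (A * m.+1%:R) `^ r^-1) `^ r.
    apply: ge0_ler_powR; rewrite ?nnegrE ?(ltW r0) ?mulr_ge0 ?powR_ge0 ?(ltW c0) ?(ltW C0)//.
  rewrite (powRM _ (ltW c0) (ltW m0)) (powRM _ (ltW C0) (powR_ge0 _ _)) in h.
  have mA : 0 <= A * m.+1%:R by rewrite mulr_ge0.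
  rewrite -powRrM mulVf ?gt_eqF// powRr1// in h.
  have mm : m.+1%:R <= 2 * m%:R :> R.
    by rewrite -natrM ler_nat mulSn mul1n -addn1 leq_add2l -(@ltr0n R).
  have e : m%:R `^ r = m%:R `^ (r - 1) * m%:R.
    rewrite -[X in _ * X]powRr1 ?(ltW m0)// -powRD ?subrK//.
    by rewrite [_ == 0 :> R]gt_eqF// implybT.
  rewrite /D ler_pdivlMr ?powR_gt0// -(ler_pM2r m0) mulrAC -e mulrC (le_trans h)//.
  rewrite -!mulrA ler_wpM2l ?powR_ge0// ler_wpM2l//.
have : (D `^ (r - 1)^-1) `^ (r - 1) < m%:R `^ (r - 1).
  by apply: gt0_ltr_powR; rewrite ?nnegrE ?powR_ge0 ?(ltW m0).
rewrite -powRrM mulVf ?gt_eqF// powRr1//.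
by rewrite ltNge mD.
Qed.

End growth.

Theorem theorem5p9 (R : realType) (d : nat) (hd : (2 <= d)%N) (q : R)
    (hq : d%:R <= q) :
  [/\ exists C : R, 0 < C /\
        forall u : 'rV[R]_d -> R, test_function u ->
          (lorentz_norm (lebesgue_rV d) q +oo
             (fun x => eucl_norm x `^ (- (d%:R / q)) * u x)%R
           <= C%:E * lorentz_norm (lebesgue_rV d) d%:R 1
                       (fun x => eucl_norm (grad u x)))%E,
      q = d%:R ->
      exists C : R, 0 < C /\
        forall u : 'rV[R]_d -> R, test_function u ->
          (lorentz_norm (lebesgue_rV d) d%:R +oo
             (fun x => u x / eucl_norm x)%R
           <= C%:E * lorentz_norm (lebesgue_rV d) d%:R 1
                       (fun x => eucl_norm (grad u x)))%E
    & forall r : \bar R, (1 < r)%E ->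
      ~ exists C : R, 0 < C /\
        forall u : 'rV[R]_d -> R, test_function u ->
          (lorentz_norm (lebesgue_rV d) q +oo
             (fun x => eucl_norm x `^ (- (d%:R / q)) * u x)%R
           <= C%:E * lorentz_norm (lebesgue_rV d) d%:R r
                       (fun x => eucl_norm (grad u x)))%E].
Proof.
case: d hd hq => [//|[//|n]] _ hq; set d := n.+2.
have q0 : 0 < q by rewrite (lt_le_trans _ hq)// ltr0n.
have part1 : exists C : R, 0 < C /\
        forall u : 'rV[R]_d -> R, test_function u ->
          (lorentz_norm (lebesgue_rV d) q +oo
             (fun x => eucl_norm x `^ (- (d%:R / q)) * u x)%R
           <= C%:E * lorentz_norm (lebesgue_rV d) d%:R 1
                       (fun x => eucl_norm (grad u x)))%E.
  pose C1 : R := d%:R * (1 + n.+1%:R^-1) * d%:R.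
  have C10 : 0 < C1 by rewrite !mulr_gt0// ltr_pwDl.
  pose C2 : R := (2 ^+ d) `^ q^-1.
  have C20 : 0 < C2 by rewrite powR_gt0// exprn_gt0.
  exists (C2 * C1); split; first exact: mulr_gt0.
  move=> u tu; have b x := test_function_sup_bound x tu.
  have N0 : (0 <= lorentz_norm (lebesgue_rV d) d%:R 1 (fun x => eucl_norm (grad u x)))%E.
    exact: poweR_ge0.
  move: b N0; case: lorentz_norm => [N| |] // b N0; last first.
    by rewrite gt0_muley ?leey// lte_fin mulr_gt0.
  have mu : measurable_fun setT u.
    by apply: continuous_measurable_rV; have [] := tu.1 [::].
  rewrite -EFinM -mulrA; apply: lorentz_weak_le => //.
  by rewrite mulr_ge0 ?(ltW C10).
split; first exact: part1.
- move=> qd; have [C [C0 hC]] := part1; exists C; split; first exact: C0.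
  move=> u tu; subst q.
  suff <- : (fun x => eucl_norm x `^ (- (d%:R / d%:R)) * u x) = (fun x => u x / eucl_norm x).
    exact: hC.
  apply/funext => x; rewrite divff ?pnatr_eq0// powRN powRr1 ?eucl_norm_ge0//.
  by rewrite mulrC.
- move=> r r1 [C [C0 hC]]; have C0' : (0 <= C%:E)%E by rewrite lee_fin ltW.
  have [c c0 hc] := @lorentz_dyadic_ge R n q q0.
  have H k := le_trans (hc k) (hC _ (@test_function_dyadic_bumps R d k)).
  (* For finite [r] the linear lower bound meets growth of order [k^(1/r)]; for [r = +oo] the
     gradient norms stay bounded in [k], so one [k] beyond [B] is enough. *)
  case: r r1 hC H => [r| |] // r1 hC H.
    have [A A0 hA] := @lorentz_dyadic_le R n r r1.
    apply: (powR_linear_growth r1 c0 C0 A0) => k.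
    by have := le_trans (H k) (lee_wpmul2l C0' (hA k)); rewrite -EFinM lee_fin.
  have hA := @lorentz_dyadic_le_oo R n.
  pose B := C * (4 * (d * (4 * d))%:R) / c.
  have B0 : 0 <= B by rewrite divr_ge0 ?mulr_ge0// ltW.
  have := le_trans (H (Num.bound B)) (lee_wpmul2l C0' (hA _)).
  rewrite -EFinM lee_fin mulrC -ler_pdivlMr//.
  by rewrite leNgt archi_boundP.
Qed.
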